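(* For any pair $(n,m)$ of positive integers and any integer $k>1$, there exist infinitely many $k$-component virtual links $L$ with unknotting index $U(L)=(n,m)$.
   Context: A $k$-component virtual link diagram is a generic immersion of $k$ circles in the plane whose double points are each marked either as a classical crossing (with over/under information) or as a virtual crossing (no over/under information). Two diagrams are equivalent if they are related by a finite sequence of classical Reidemeister moves RI, RII, RIII, virtual Reidemeister moves VRI, VRII, VRIII (the analogues of RI, RII, RIII in which all crossings are virtual), and the semi-virtual move SV (moving an arc having only virtual crossings across a classical crossing), together with planar isotopy. A $k$-component virtual link $L$ is an equivalence class of $k$-component virtual link diagrams; $[L]$ denotes the set of its diagrams. The $k$-component trivial link is the class of the crossingless diagram of $k$ disjoint, unnested circles. Virtualizing a classical crossing means replacing it by a virtual crossing; a crossing change means exchanging the over and under strands at a classical crossing. For non-negative integers $n,m$, a virtual link diagram $D$ is $(n,m)$-unknottable if, by virtualizing $n$ classical crossings of $D$ and applying crossing changes at $m$ classical crossings of $D$, one obtains a diagram of the trivial link. The unknotting index $U(D)$ of the diagram $D$ is the minimum, in the dictionary (lexicographic) order, of all pairs $(n,m)$ such that $D$ is $(n,m)$-unknottable. The unknotting index of a virtual link $L$ is $U(L)=\min\{U(D) : D\in [L]\}$, the minimum again being taken in the dictionary order. *)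

(* Defs.v *)
From mathcomp Require Import all_boot all_order.
From mathcomp Require Import boolp classical_sets functions cardinality.
From Stdlib Require Import Relations.Relation_Operators.

Set Implicit Arguments.
Unset Strict Implicit.
Unset Printing Implicit Defensive.

Import Order.TTheory.

Local Open Scope nat_scope.

(* A planar diagram is put in general position with respect to the height     *)
(* function and read from bottom to top as a word of slices.  The slice       *)
(* (p, i) holds one elementary piece p, with exactly i vertical strands on    *)
(* its left, all its other strands being vertical too.  Every generic         *)
(* immersion of circles in the plane is planar isotopic to one of this form.  *)

(* [Classical b]: the over strand is the one going from bottom left to top    *)
(* right if b is true, the one from bottom right to top left otherwise.       *)
Variant crossing := Classical of bool | Virtual.

(* Cup is a local minimum, Cap a local maximum of the height.                 *)
Variant piece := Cup | Cap | Cross of crossing.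

Definition slice : Type := (piece * nat)%type.

Definition inputs (p : piece) : nat := if p is Cup then 0 else 2.
Definition outputs (p : piece) : nat := if p is Cap then 0 else 2.

Definition crossing_change (c : crossing) : crossing :=
  if c is Classical b then Classical (~~ b) else Virtual.

(* None when the slice does not fit on n strands.                             *)
Definition stack (n : option nat) (s : slice) : option nat :=
  if n is Some n then
    if s.2 + inputs s.1 <= n then Some (n - inputs s.1 + outputs s.1) else None
  else None.

Definition strands_after (w : seq slice) : option nat := foldl stack (Some 0) w.

Definition is_diagram (w : seq slice) : bool := strands_after w == Some 0.

Definition diagram : Type := {w : seq slice | is_diagram w}.

Definition word (D : diagram) : seq slice := sval D.

(* (l, j) is the j-th point, from the left, of the diagram on the horizontal  *)
(* line just below the l-th slice, and each slice joins some of these points  *)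
(* by arcs.  The components of a diagram are the connected components of the  *)
(* resulting graph; every circle meets a line since it leaves a local minimum.*)

Definition width (w : seq slice) (l : nat) : nat :=
  odflt 0 (strands_after (take l w)).

Definition slice_arcs (w : seq slice) (l : nat) :
    seq ((nat * nat) * (nat * nat)) :=
  let: (p, i) := nth (Cup, 0) w l in
  [seq ((l, j), (l.+1, j)) | j <- iota 0 i]
  ++ [seq ((l, j + inputs p), (l.+1, j + outputs p))
       | j <- iota i (width w l - inputs p - i)]
  ++ match p with
     | Cup => [:: ((l.+1, i), (l.+1, i.+1))]
     | Cap => [:: ((l, i), (l, i.+1))]
     | Cross _ => [:: ((l, i), (l.+1, i.+1)); ((l, i.+1), (l.+1, i))]
     end.

Definition arcs (w : seq slice) : seq ((nat * nat) * (nat * nat)) :=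
  flatten [seq slice_arcs w l | l <- iota 0 (size w)].

Definition point (w : seq slice) : finType :=
  {l : 'I_(size w).+1 & 'I_(width w l)}.

Definition coordinates (w : seq slice) (x : point w) : nat * nat :=
  (nat_of_ord (tag x), nat_of_ord (tagged x)).

Definition joined (w : seq slice) : rel (point w) := fun x y =>
  ((coordinates x, coordinates y) \in arcs w)
  || ((coordinates y, coordinates x) \in arcs w).

Definition components (D : diagram) : nat :=
  n_comp (@joined (word D)) predT.

(* Three strands crossing pairwise: a is the crossing of the strands starting *)
(* first and second from the left, b that of the first and third, c that of   *)
(* the second and third.                                                      *)
Variant triangle : crossing -> crossing -> crossing -> Prop :=
(* Of the 8 labellings, two (a = c <> b) make the three strands cyclically    *)
(* over one another; they are not RIII configurations.                        *)
| RIII a b c : (b == a) || (b == c) ->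
    triangle (Classical a) (Classical b) (Classical c)
| VRIII : triangle Virtual Virtual Virtual
| SV_first c : triangle Virtual Virtual (Classical c)
| SV_second b : triangle Virtual (Classical b) Virtual
| SV_third a : triangle (Classical a) Virtual Virtual.

(* Planar isotopies of diagrams in general position for the height are        *)
(* generated by: two pieces exchanging heights ([isotopy_exchange]), the      *)
(* birth or death of a pair of critical points ([isotopy_zigzag]), and a      *)
(* critical point of one strand travelling through a crossing                 *)
(* ([isotopy_slide]).  In a slide the over strand stays over: the label is    *)
(* switched because the strand of the cap (cup) changes slope.                *)
(* The Reidemeister moves are needed for one orientation in the plane only,   *)
(* as the others result by conjugating with isotopies.                        *)
Variant local_move : seq slice -> seq slice -> Prop :=
| isotopy_exchange p q i j :
    local_move [:: (p, i); (q, i + outputs p + j)]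
               [:: (q, i + inputs p + j); (p, i)]
| isotopy_zigzag_left i : local_move [:: (Cup, i); (Cap, i.+1)] [::]
| isotopy_zigzag_right i : local_move [:: (Cup, i.+1); (Cap, i)] [::]
| isotopy_slide_cap c i :
    local_move [:: (Cross c, i.+1); (Cap, i)]
               [:: (Cross (crossing_change c), i); (Cap, i.+1)]
| isotopy_slide_cup c i :
    local_move [:: (Cup, i); (Cross c, i.+1)]
               [:: (Cup, i.+1); (Cross (crossing_change c), i)]
| RI b i : local_move [:: (Cross (Classical b), i); (Cap, i)] [:: (Cap, i)]
| VRI i : local_move [:: (Cross Virtual, i); (Cap, i)] [:: (Cap, i)]
| RII b i :
    local_move [:: (Cross (Classical b), i); (Cross (Classical (~~ b)), i)] [::]
| VRII i : local_move [:: (Cross Virtual, i); (Cross Virtual, i)] [::]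
| triangle_move a b c i : triangle a b c ->
    local_move [:: (Cross a, i); (Cross b, i.+1); (Cross c, i)]
               [:: (Cross c, i.+1); (Cross b, i); (Cross a, i.+1)].

Definition move (D E : diagram) : Prop :=
  exists below above u v,
    [/\ local_move u v,
        word D = below ++ u ++ above & word E = below ++ v ++ above].

Definition equivalent : diagram -> diagram -> Prop :=
  clos_refl_sym_trans diagram move.

(* L is the class itself, so that D \in [L] is L D.                           *)
Definition virtual_link (k : nat) (L : set diagram) : Prop :=
  exists D : diagram, components D = k /\ L = [set E | equivalent D E]%classic.

Definition trivial_word (k : nat) : seq slice :=
  flatten (nseq k [:: (Cup, 0); (Cap, 0)]).

Lemma trivial_word_is_diagram (k : nat) : is_diagram (trivial_word k).
Proof.
by elim: k => //= k; rewrite /is_diagram /trivial_word /strands_after.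
Qed.

Definition trivial_diagram (k : nat) : diagram :=
  exist _ (trivial_word k) (trivial_word_is_diagram k).

(* [modified n m u v]: v results from u by virtualizing n classical crossings *)
(* and changing m other ones.                                                 *)
Inductive modified : nat -> nat -> seq slice -> seq slice -> Prop :=
| modified_nil : modified 0 0 [::] [::]
| modified_keep n m s u v :
    modified n m u v -> modified n m (s :: u) (s :: v)
| modified_virtualize n m b i u v :
    modified n m u v ->
    modified n.+1 m ((Cross (Classical b), i) :: u) ((Cross Virtual, i) :: v)
| modified_change n m b i u v :
    modified n m u v ->
    modified n m.+1 ((Cross (Classical b), i) :: u)
                    ((Cross (crossing_change (Classical b)), i) :: v).

Definition unknottable (D : diagram) (p : nat * nat) : Prop :=
  exists E : diagram, modified p.1 p.2 (word D) (word E)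
                      /\ equivalent E (trivial_diagram (components D)).

Definition dictionary_min (A : set (nat * nat)) (p : nat * nat) : Prop :=
  A p /\ forall q, A q -> ((p : nat *l nat) <= (q : nat *l nat))%O.

Definition diagram_index (D : diagram) (p : nat * nat) : Prop :=
  dictionary_min (unknottable D) p.

Definition unknotting_index (L : set diagram) (p : nat * nat) : Prop :=
  dictionary_min [set q | exists2 D, L D & diagram_index D q]%classic p.

(* Main.v *)
(* Colour the strands of a diagram by an orientation together with a choice   *)
(* of a first and a second sublink.  Two quantities are read off a coloured   *)
(* diagram: the span, which counts the classical crossings between the two    *)
(* sublinks where the first is over minus those where the second is over,     *)
(* with signs, and the index-i writhe of the first sublink, the signed number *)
(* of its self-crossings of affine index i (Kauffman), the index being read   *)
(* off an integer labelling of the arcs.  The set of pairs obtained from all  *)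
(* colourings is an invariant.  Virtualizing a crossing changes the span by   *)
(* at most 1, and by 0 at a self-crossing of a sublink, while a crossing      *)
(* change does not alter it; so if n virtualizations kill a span n, all of    *)
(* them took place at mixed crossings and left the labels and the writhes     *)
(* alone.  A crossing change reverses both the sign and the index of the      *)
(* crossing, hence moves the index-i writhe by at most 1 when i is not 0.  So *)
(* a link coloured with span n and index-i writhe m has unknotting index at   *)
(* least (n, m).                                                              *)
(* The diagrams of [pattern] attain this bound: n virtualizations separate    *)
(* two components, and m crossing changes turn m clasps of index (i, -i) of   *)
(* one of them into second Reidemeister pairs.  Different i give different    *)
(* links because the writhe then sits at different indices.                   *)

(* For every f with f(0) = 0, the pairs (span, f-weighted writhe) attained by the colourings of a
   diagram are invariant under all moves ([sem_equivalent]); a crossingless diagram attains only (0,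
   0).

   Suppose n' virtualizations and m' crossing changes lead to a trivial diagram. By
   [modified_weights], orientations and sublinks survive every modification, so spans can always be
   compared: the span drops by at most 1 per virtualization. Labels need not survive the
   virtualization of a self-crossing; but if the span drops by exactly n', all virtualized crossings
   are mixed, the labels survive too, and the writhe moves by at most 1 per crossing change. A
   colouring of weight (n, m) therefore forces (n, m) <= (n', m') in the dictionary order
   ([lower_bound]).

   The pattern with parameter r has such a colouring when f is the indicator of index r
   ([pattern_sem]), and n virtualizations and m crossing changes do trivialize it
   ([modified_pattern], [pattern_trivial]). Span n > 0 together with a nonzero writhe at index r is
   attained by no pattern with another parameter ([sem_pattern_indicator]), so distinct r give
   distinct links. The number of components is computed in [components_pattern]. *)
From Stdlib Require Import ZArith Lia.
Require Import Defs.
From mathcomp Require Import all_boot all_order.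
From mathcomp Require Import boolp classical_sets functions cardinality.
From mathcomp Require Import zify.
From Stdlib Require Import Relations.Relation_Operators.

Set Implicit Arguments.
Unset Strict Implicit.
Unset Printing Implicit Defensive.

Local Open Scope nat_scope.

(** * Colourings of diagrams, with span and writhe *)

#[local] Arguments Z.mul : simpl never.
#[local] Arguments Z.add : simpl never.
#[local] Arguments Z.sub : simpl never.
#[local] Arguments Z.opp : simpl never.
#[local] Arguments Z.of_nat : simpl never.

(* First s and Second s put a strand in the first or second sublink, oriented *)
(* upwards if s is true; Blank strands are disregarded.                       *)
Variant kind := First of bool | Second of bool | Blank.

Definition reverse (a : kind) : kind :=
  match a with
  | First s => First (~~ s)
  | Second s => Second (~~ s)
  | Blank => Blank
  end.

Definition sgn (s : bool) : Z := if s then 1%Z else (-1)%Z.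

Definition dir1 (a : kind) : Z := if a is First s then sgn s else 0%Z.
Definition dir2 (a : kind) : Z := if a is Second s then sgn s else 0%Z.

Definition color : Type := (kind * Z)%type.
Definition opp (x : color) : color := (reverse x.1, x.2).
Definition blank : color := (Blank, 0%Z).
Definition shift (d : Z) (x : color) : color := (x.1, x.2 + d)%Z.

(* At a classical self-crossing of the first sublink, the label of each       *)
(* strand is h larger to the right of the other strand than to its left.      *)
(* With h = 1 the labels compute affine indices; with h = 0 they are constant.*)
Definition jump (h : Z) (a b : kind) : Z := (h * (dir1 a * dir1 a) * dir1 b)%Z.
(** A crossing change reverses both the sign of a mixed crossing and which sublink is over; the two
    effects cancel, so the over/under datum does not occur. *)
Definition span (a b : kind) : Z := (dir1 a * dir2 b - dir2 a * dir1 b)%Z.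
(* For h = 1, twice the affine index of a crossing at which x is over y; x is *)
(* the strand starting from the left.                                         *)
Definition gap (h : Z) (x y : color) : Z :=
  (2 * (x.2 - y.2) + h * (dir1 x.1 + dir1 y.1))%Z.
(** The inner [sgn b] reads the index from the over strand, so that a crossing change negates it;
    [f] weighs the indices. *)
Definition writhe (h : Z) (f : Z -> Z) (b : bool) (x y : color) : Z :=
  (sgn b * (dir1 x.1 * dir1 y.1) * f (sgn b * gap h x y))%Z.

Definition cross_left (h : Z) (c : crossing) (x y : color) : color :=
  if c is Classical _ then shift (- jump h y.1 x.1) y else y.
Definition cross_right (h : Z) (c : crossing) (x y : color) : color :=
  if c is Classical _ then shift (jump h x.1 y.1) x else x.

Definition weight (h : Z) (f : Z -> Z) (c : crossing) (x y : color) : Z * Z :=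
  if c is Classical b then (span x.1 y.1, writhe h f b x y) else (0%Z, 0%Z).

Definition addw (v w : Z * Z) : Z * Z := (v.1 + w.1, v.2 + w.2)%Z.

(* A horizontal line is coloured as if it met infinitely many strands: local  *)
(* moves can then be compared without regard to the number of strands.        *)
Definition state : Type := nat -> color.
Definition config : Type := (state * (Z * Z))%type.

Definition scons (x : color) (s : state) : state :=
  fun j => if j is j'.+1 then s j' else x.
Definition stail (s : state) : state := fun j => s j.+1.

(** A relation rather than a function: a cup may take any colour, and a cap constrains the two
    strands that it joins. *)
Definition at_bottom (h : Z) (f : Z -> Z) (p : piece) (C C' : config) : Prop :=
  match p with
  | Cup => exists x, C' = (scons x (scons (opp x) C.1), C.2)
  | Cap => exists x, C = (scons x (scons (opp x) C'.1), C'.2)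
  | Cross c => exists x y s w, C = (scons x (scons y s), w) /\
      C' = (scons (cross_left h c x y) (scons (cross_right h c x y) s),
            addw w (weight h f c x y))
  end.

Fixpoint right_of (i : nat) (R : config -> config -> Prop) (C C' : config) : Prop :=
  if i is i'.+1 then
    C.1 0 = C'.1 0 /\ right_of i' R (stail C.1, C.2) (stail C'.1, C'.2)
  else R C C'.

Fixpoint sem (h : Z) (f : Z -> Z) (w : seq slice) (C C' : config) : Prop :=
  if w is s :: w' then
    exists2 B, right_of s.2 (at_bottom h f s.1) C B & sem h f w' B C'
  else C = C'.

(** * Composition, translation and single slices *)

Lemma scons_stail (s : state) : scons (s 0) (stail s) = s.
Proof. by apply: funext; case. Qed.

Lemma scons_inj (x y : color) (s t : state) :
  scons x s = scons y t -> x = y /\ s = t.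
Proof.
move=> E; split; first by have := congr1 (fun r => r 0) E.
by have := congr1 stail E.
Qed.

Lemma state_eq (s t : state) : s 0 = t 0 -> stail s = stail t -> s = t.
Proof. by move=> E F; rewrite -(scons_stail s) -(scons_stail t) E F. Qed.

Lemma reverseK : involutive reverse.
Proof. by case=> // s; rewrite /= negbK. Qed.

Lemma oppK : involutive opp.
Proof. by case=> k a; rewrite /opp /= reverseK. Qed.

Lemma sem_cat (h : Z) (f : Z -> Z) (u v : seq slice) (C C' : config) :
  sem h f (u ++ v) C C' <-> exists2 B, sem h f u C B & sem h f v B C'.
Proof.
elim: u C => [|s u IH] C /=.
  by split=> [H|[B <- //]]; exists C.
split=> [[B H /IH[B' H1 H2]]|[B' [B H H1] H2]].
  by exists B' => //; exists B.
by exists B => //; apply/IH; exists B'.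
Qed.

Lemma right_of_add (i j : nat) (R : config -> config -> Prop) (C C' : config) :
  right_of (i + j) R C C' <-> right_of i (right_of j R) C C'.
Proof.
elim: i C C' => [|i IH] C C' //=.
by split=> -[-> /IH].
Qed.

Lemma right_of_iff (i : nat) (R S : config -> config -> Prop) :
  (forall C C', R C C' <-> S C C') ->
  forall C C', right_of i R C C' <-> right_of i S C C'.
Proof.
move=> RS; elim: i => [|i IH] C C' //=.
by split=> -[-> /IH].
Qed.

Definition raise (i : nat) (w : seq slice) : seq slice :=
  [seq (s.1, i + s.2) | s <- w].

(** Reduces each local move to the case of no strand on its left. *)
Lemma sem_raise (h : Z) (f : Z -> Z) (i : nat) (w : seq slice) (C C' : config) :
  sem h f (raise i w) C C' <-> right_of i (sem h f w) C C'.
Proof.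
elim: w i C C' => [|[p j] w IH] i C C' /=.
  elim: i C C' => [|i IH] [s w] [s' w'] //=; split.
    by move=> [-> ->]; split=> //; apply/IH.
  by move=> [E /IH [F ->]]; rewrite (state_eq E F).
split.
  move=> [B /right_of_add H /IH H1].
  elim: i C B C' H H1 {IH} => [|i IH] C B C' /=; first by exists B.
  by move=> [-> H] [-> H1]; split=> //; apply: IH H H1.
move=> H.
suff [B] : exists2 B, right_of i (right_of j (at_bottom h f p)) C B &
    right_of i (sem h f w) B C'.
  by move=> /right_of_add H1 /IH H2; exists B.
elim: i C C' H {IH} => [|i IH] C C' //=.
move=> [E /IH[[s w1] H1 H2]]; exists (scons (C.1 0) s, w1) => //=.
Qed.

Lemma right_of_addw (h : Z) (f : Z -> Z) (p : piece) (i : nat) (s s' : state)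
    (w w' d : Z * Z) :
  right_of i (at_bottom h f p) (s, w) (s', w') ->
  right_of i (at_bottom h f p) (s, addw w d) (s', addw w' d).
Proof.
elim: i s s' => [|i IH] s s' /=; last by move=> [-> /IH].
case: p => [[x [-> ->]]|[x [-> ->]]|c [x [y [t [v [[-> ->] [-> ->]]]]]]].
- by exists x.
- by exists x.
exists x, y, t, (addw v d); split=> //; congr pair.
rewrite /addw /=; congr pair; lia.
Qed.

Lemma dir1_reverse (a : kind) : dir1 (reverse a) = (- dir1 a)%Z.
Proof. by case: a => [[]|[]|]. Qed.
Lemma dir2_reverse (a : kind) : dir2 (reverse a) = (- dir2 a)%Z.
Proof. by case: a => [[]|[]|]. Qed.
Lemma dir1_cube (a : kind) : (dir1 a * dir1 a * dir1 a = dir1 a)%Z.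
Proof. by case: a => [[]|[]|]. Qed.

(* A strand passing across a crossing moves both labels by the same amount.   *)
Lemma writhe_shift (h : Z) (f : Z -> Z) (b : bool) (x y : color) (t : kind) :
  writhe h f b (shift (jump h x.1 t) x) (shift (jump h y.1 t) y) = writhe h f b x y.
Proof.
case: x y => [a i] [c j]; rewrite /writhe /gap /jump /=.
case: a => [s|s|]; [case: c => [s'|s'|]|..]; rewrite /= ?Z.mul_0_r //.
congr (_ * f (_ * _))%Z.
have -> : (sgn s * sgn s = 1)%Z by case: s.
have -> : (sgn s' * sgn s' = 1)%Z by case: s'.
ring.
Qed.

Definition crossed (h : Z) (f : Z -> Z) (c : crossing) (x y : color) (C : config) :
    config :=
  (scons (cross_left h c x y) (scons (cross_right h c x y) C.1),
   addw C.2 (weight h f c x y)).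

Lemma cross_at0 (h : Z) (f : Z -> Z) (c : crossing) (x y : color) (s : state)
    (w : Z * Z) (C : config) :
  right_of 0 (at_bottom h f (Cross c)) (scons x (scons y s), w) C <->
  C = crossed h f c x y (s, w).
Proof.
split=> [[x' [y' [t [v [[/scons_inj[-> /scons_inj[-> ->]] ->] ->]]]]]//|->].
by exists x, y, s, w.
Qed.

Lemma cross_at1 (h : Z) (f : Z -> Z) (c : crossing) (a x y : color) (s : state)
    (w : Z * Z) (C : config) :
  right_of 1 (at_bottom h f (Cross c)) (scons a (scons x (scons y s)), w) C <->
  C = (scons a (crossed h f c x y (s, w)).1, (crossed h f c x y (s, w)).2).
Proof.
case: C => t v; split=> [[/= E /cross_at0[F ->]]|[-> ->]].
  by congr pair; apply: state_eq.
by split=> //; apply/cross_at0.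
Qed.

Lemma cap_at0 (h : Z) (f : Z -> Z) (x y : color) (s : state) (w : Z * Z)
    (C : config) :
  right_of 0 (at_bottom h f Cap) (scons x (scons y s), w) C <->
  y = opp x /\ C = (s, w).
Proof.
case: C => t v; split=> [[a [/scons_inj[-> /scons_inj[-> ->]] ->]] //|].
by move=> [-> [-> ->]]; exists x.
Qed.

Lemma cap_at1 (h : Z) (f : Z -> Z) (a x y : color) (s : state) (w : Z * Z)
    (C : config) :
  right_of 1 (at_bottom h f Cap) (scons a (scons x (scons y s)), w) C <->
  y = opp x /\ C = (scons a s, w).
Proof.
case: C => t v; split=> [[E /(@cap_at0 h f x y s w)[-> [F ->]]]|[-> [-> ->]]].
  by split=> //; congr pair; apply: state_eq.
by split=> //; apply/cap_at0.
Qed.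

Lemma cup_at1 (h : Z) (f : Z -> Z) (a : color) (s : state) (w : Z * Z)
    (C : config) :
  right_of 1 (at_bottom h f Cup) (scons a s, w) C <->
  exists x, C = (scons a (scons x (scons (opp x) s)), w).
Proof.
case: C => t v; split=> [[/= E [x [F ->]]]|[x [-> ->]]].
  by exists x; congr pair; apply: state_eq.
by split=> //; exists x.
Qed.

Lemma sem_det (h : Z) (f : Z -> Z) (i : nat) (p : piece) (w : seq slice)
    (C B C' : config) :
  (forall B', right_of i (at_bottom h f p) C B' <-> B' = B) ->
  sem h f ((p, i) :: w) C C' <-> sem h f w B C'.
Proof.
move=> H /=; split=> [[B' /H -> //]|S]; exists B => //; exact/H.
Qed.

Lemma jump_rev (h : Z) (a b : kind) : jump h a (reverse b) = (- jump h a b)%Z.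
Proof. rewrite /jump dir1_reverse; ring. Qed.
Lemma rev_jump (h : Z) (a b : kind) : jump h (reverse a) b = jump h a b.
Proof. rewrite /jump dir1_reverse; ring. Qed.

Lemma shift_opp (d : Z) (x : color) : opp (shift d x) = shift d (opp x).
Proof. by []. Qed.
Lemma shiftD (d e : Z) (x : color) : shift d (shift e x) = shift (d + e) x.
Proof. rewrite /shift /=; congr pair; lia. Qed.
Lemma shift0 (x : color) : shift 0 x = x.
Proof. by case: x => a b; rewrite /shift /= Z.add_0_r. Qed.
Lemma shiftK (d : Z) (x : color) : shift (- d) (shift d x) = x.
Proof. by rewrite shiftD Z.add_opp_diag_l shift0. Qed.

Lemma addwA (a b c : Z * Z) : addw a (addw b c) = addw (addw a b) c.
Proof. rewrite /addw /=; congr pair; lia. Qed.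
Lemma addw0 (a : Z * Z) : addw a (0, 0)%Z = a.
Proof. by case: a => a b; rewrite /addw /= !Z.add_0_r. Qed.

Lemma sem_raise_iff (h : Z) (f : Z -> Z) (i : nat) (u v : seq slice) :
  (forall C C', sem h f u C C' <-> sem h f v C C') ->
  forall C C', sem h f (raise i u) C C' <-> sem h f (raise i v) C C'.
Proof.
move=> H C C'; split=> /sem_raise S; apply/sem_raise; exact/(right_of_iff i H).
Qed.

Lemma state_cons2 (s : state) : exists x y t, s = scons x (scons y t).
Proof. by exists (s 0), (s 1), (stail (stail s)); rewrite !scons_stail. Qed.

Lemma sem_two (h : Z) (f : Z -> Z) (s t : slice) (C C' : config) :
  sem h f [:: s; t] C C' <->
  exists2 B, right_of s.2 (at_bottom h f s.1) C B & right_of t.2 (at_bottom h f t.1) B C'.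
Proof.
split=> /= [[B H [B' H' E]]|[B H H']]; exists B => //; first by rewrite -E.
by exists C'.
Qed.

Lemma addw_inv (a d : Z * Z) : exists b, a = addw b d.
Proof.
exists (a.1 - d.1, a.2 - d.2)%Z; case: a => a b; rewrite /addw /=; congr pair; lia.
Qed.

(** * Invariance under isotopies and Reidemeister moves *)

Lemma sem_exchange (h : Z) (f : Z -> Z) (p q : piece) (j : nat) (C C' : config) :
  sem h f [:: (p, 0); (q, outputs p + j)] C C' <->
  sem h f [:: (q, inputs p + j); (p, 0)] C C'.
Proof.
case: C C' => [s w] [s' w'].
split=> /sem_two [[t v] H1 H2]; apply/sem_two; case: p H1 H2 => [||c].
- move=> [x [-> ->]] [E [F H]]; exists (stail (stail s'), w') => //.
  by exists x; congr pair; apply: state_eq => //; apply: state_eq.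
- move=> [x [-> ->]] H.
  by exists (scons x (scons (opp x) s'), w') => //; exists x.
- have [x [y [r ->]]] := state_cons2 s.
  move=> /cross_at0 [-> ->] [E [F H]].
  (* Weights add up along the word, so the intermediate weight is the final one less the
     contribution of the crossing. *)
  have [v' Ew'] := addw_inv w' (weight h f c x y).
  exists (scons x (scons y (stail (stail s'))), v').
    split=> //; split=> //=.
    have K a d : a = addw (addw a d) (- d.1, - d.2)%Z.
      by case: a => k l; rewrite /addw /=; congr pair; lia.
    rewrite (K w (weight h f c x y)) (K v' (weight h f c x y)) -Ew'.
    exact: right_of_addw.
  apply/cross_at0; congr pair => //.
  by apply: state_eq => //; apply: state_eq.
- move=> H [x [-> ->]].
  by exists (scons x (scons (opp x) s), w); [exists x | ].
- move=> [E [F H]] [x [G Ev]]; move: E F H; rewrite G Ev /= => E F H.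
  exists (stail (stail s), w) => //.
  by exists x; congr pair; apply: state_eq => //; apply: state_eq.
- move=> [E [F H]] [x [y [r [v' [[G Ev] [-> ->]]]]]].
  move: E F H; rewrite G Ev /= => E F H.
  exists (crossed h f c x y (stail (stail s), w)).
    rewrite -(scons_stail s) -(scons_stail (stail s)) E F; exact/cross_at0.
  by split=> //; split=> //; apply: right_of_addw.
Qed.

(** The two crossings of a second move have opposite signs and the same index. *)
Lemma writhe_RII (h : Z) (f : Z -> Z) (b : bool) (x y : color) :
  writhe h f (~~ b) (shift (- jump h y.1 x.1) y) (shift (jump h x.1 y.1) x) =
  (- writhe h f b x y)%Z.
Proof.
case: x y => [[s|s|] a] [[t|t|] c]; rewrite /writhe /gap /jump /=; try ring.
set X := f _; set Y := f _.
have -> : X = Y by rewrite /X /Y; congr f; case: (b); case: (s); case: (t) => /=; ring.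
by case: (b); rewrite /=; ring.
Qed.

Lemma cross_RII (h : Z) (f : Z -> Z) (b : bool) (x y : color) (s : state)
    (w : Z * Z) :
  crossed h f (Classical (~~ b)) (cross_left h (Classical b) x y)
    (cross_right h (Classical b) x y)
    (s, addw w (weight h f (Classical b) x y)) = (scons x (scons y s), w).
Proof.
rewrite /crossed /= !shiftD Z.add_opp_diag_r Z.add_opp_diag_l !shift0.
congr pair; rewrite -addwA -[RHS]addw0; congr addw; rewrite /addw /=; congr pair.
  rewrite /span; ring.
by rewrite writhe_RII Z.add_opp_diag_r.
Qed.

Lemma sem_RII (h : Z) (f : Z -> Z) (b : bool) (C C' : config) :
  sem h f [:: (Cross (Classical b), 0); (Cross (Classical (~~ b)), 0)] C C' <->
  sem h f [::] C C'.
Proof.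
case: C => s w; have [x [y [t ->]]] := state_cons2 s.
rewrite (sem_det _ _ (cross_at0 h f (Classical b) x y t w)).
by rewrite (sem_det _ _ (cross_at0 h f (Classical (~~ b)) _ _ t _)) cross_RII.
Qed.

Lemma sem_VRII (h : Z) (f : Z -> Z) (C C' : config) :
  sem h f [:: (Cross Virtual, 0); (Cross Virtual, 0)] C C' <-> sem h f [::] C C'.
Proof.
case: C => s w; have [x [y [t ->]]] := state_cons2 s.
rewrite (sem_det _ _ (cross_at0 h f Virtual x y t w)).
by rewrite (sem_det _ _ (cross_at0 h f Virtual _ _ t _)) /= /crossed /= !addw0.
Qed.

Lemma sem_zigzag_left (h : Z) (f : Z -> Z) (C C' : config) :
  sem h f [:: (Cup, 0); (Cap, 1)] C C' <-> sem h f [::] C C'.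
Proof.
case: C => s w; rewrite -(scons_stail s); split.
  move=> /sem_two [B [x ->] /cap_at1[E ->]] /=.
  by rewrite E oppK.
move=> <-; apply/sem_two.
exists (scons (s 0) (scons (opp (s 0)) (scons (s 0) (stail s))), w).
  by exists (s 0).
by apply/cap_at1; rewrite oppK.
Qed.

Lemma sem_zigzag_right (h : Z) (f : Z -> Z) (C C' : config) :
  sem h f [:: (Cup, 1); (Cap, 0)] C C' <-> sem h f [::] C C'.
Proof.
case: C => s w; rewrite -(scons_stail s); split.
  by move=> /sem_two [B /cup_at1[x ->] /cap_at0[-> ->]] /=; rewrite oppK.
move=> <-; apply/sem_two.
exists (scons (s 0) (scons (opp (s 0)) (scons (s 0) (stail s))), w).
  by apply/cup_at1; exists (opp (s 0)); rewrite oppK.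
exact/cap_at0.
Qed.

Lemma opp_sym (x y : color) : x = opp y <-> y = opp x.
Proof. by split=> ->; rewrite oppK. Qed.

(** The strands of a kink have equal labels and opposite directions, so the gap is 0 and [f 0 = 0]
    removes the writhe. Both labels shift alike, so the cap imposes the same condition above and
    below the crossing. *)
Lemma sem_RI (h : Z) (f : Z -> Z) (c : crossing) (C C' : config) : f 0%Z = 0%Z ->
  sem h f [:: (Cross c, 0); (Cap, 0)] C C' <-> sem h f [:: (Cap, 0)] C C'.
Proof.
move=> f0; case: C => s w; have [x [y [t ->]]] := state_cons2 s.
rewrite (sem_det _ _ (cross_at0 h f c x y t w)).
suff H : cross_right h c x y = opp (cross_left h c x y) <-> y = opp x.
  have K : y = opp x -> addw w (weight h f c x y) = w.
    move=> ->; rewrite -[RHS]addw0; congr addw; case: c {H} => [b|//] /=.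
    rewrite /span /writhe /gap /= dir1_reverse dir2_reverse.
    rewrite Z.sub_diag Z.add_opp_diag_r !Z.mul_0_r f0; congr pair; ring.
  split=> [[B /cap_at0[/H E ->] <-]|[B /cap_at0[E ->] <-]].
    by exists (t, w); [apply/cap_at0 | rewrite /= K].
  exists (t, addw w (weight h f c x y)); last by rewrite /= K.
  by apply/cap_at0; split=> //; apply/H.
case: c => [b|] /=; last exact: opp_sym.
split.
  case: x y => [k a] [l e] [/= -> E]; rewrite /opp reverseK /=; congr pair.
  move: E; rewrite rev_jump jump_rev /jump; lia.
by move=> ->; rewrite shift_opp oppK /= jump_rev rev_jump.
Qed.

(** The label of the crossing and the direction of the strand of the cap are reversed together,
    which keeps the sign and the index. *)
Lemma sem_slide_cap (h : Z) (f : Z -> Z) (c : crossing) (C C' : config) :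
  sem h f [:: (Cross c, 1); (Cap, 0)] C C' <->
  sem h f [:: (Cross (crossing_change c), 0); (Cap, 1)] C C'.
Proof.
case: C => s w; rewrite -(scons_stail s).
have [q [r [t ->]]] := state_cons2 (stail s); move: (s 0) => p {s}.
rewrite (sem_det _ _ (cross_at1 h f c p q r t w)).
rewrite (sem_det _ _ (cross_at0 h f (crossing_change c) p q (scons r t) w)).
suff H : [/\ cross_left h c q r = opp p
           <-> r = opp (cross_right h (crossing_change c) p q) &
           r = opp (cross_right h (crossing_change c) p q) ->
           cross_right h c q r = cross_left h (crossing_change c) p q /\
           weight h f c q r = weight h f (crossing_change c) p q].
  have [H1 H2] := H.
  split=> [[B /cap_at0[/H1 E ->] <-]|[B /cap_at1[E ->] <-]].
    rewrite /crossed /=; have [-> ->] := H2 E; eexists; last by [].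
    exact/cap_at1.
  rewrite /crossed /=; have [<- <-] := H2 E; eexists; last by [].
  by apply: (proj2 (cap_at0 h f p _ _ _ _)); split=> //; apply/H1.
case: c => [b|] /=; last by split.
split.
  rewrite shift_opp; split.
    move=> E; have -> : r = shift (jump h r.1 q.1) (opp p).
      by rewrite -E shiftD Z.add_opp_diag_r shift0.
    have -> : r.1 = reverse p.1 by have := congr1 (fun x => x.1) E.
    by rewrite rev_jump.
  by move=> -> /=; rewrite rev_jump shiftK.
move=> ->; split=> /=; first by rewrite jump_rev.
rewrite /span /writhe /gap /= !dir1_reverse !dir2_reverse; congr pair; first ring.
case: p q => [[s|s|] a] [[u|u|] e]; rewrite /jump /=; try ring.
set X := f _; set Y := f _.
have -> : X = Y by rewrite /X /Y; congr f; case: (b); case: (s); case: (u) => /=; ring.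
by case: (b); rewrite /=; ring.
Qed.

Lemma sem_slide_cup (h : Z) (f : Z -> Z) (c : crossing) (C C' : config) :
  sem h f [:: (Cup, 0); (Cross c, 1)] C C' <->
  sem h f [:: (Cup, 1); (Cross (crossing_change c), 0)] C C'.
Proof.
case: C => s w; rewrite -(scons_stail s); move: (s 0) (stail s) => q t {s}.
have K y : let x := cross_left h (crossing_change c) q y in
    [/\ cross_left h c (opp x) q = cross_right h (crossing_change c) q y,
        cross_right h c (opp x) q = opp y &
        weight h f c (opp x) q = weight h f (crossing_change c) q y].
  case: c => [b|] //=; split.
  - by rewrite jump_rev Z.opp_involutive.
  - by rewrite shift_opp shiftD rev_jump Z.add_opp_diag_r shift0.
  rewrite /span /writhe /gap /= !dir1_reverse !dir2_reverse; congr pair; first ring.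
  case: q y => [[s|s|] a] [[u|u|] e]; rewrite /jump /=; try ring.
  set X := f _; set Y := f _.
  have -> : X = Y by rewrite /X /Y; congr f; case: (b); case: (s); case: (u) => /=; ring.
  by case: (b); rewrite /=; ring.
have L x : exists y, x = cross_left h (crossing_change c) q y.
  case: (c) => [b|] /=; last by exists x.
  by exists (shift (jump h x.1 q.1) x); rewrite shiftK.
split=> /sem_two [B].
  move=> [x ->] /cross_at1 ->; apply/sem_two; have [y ->] := L x.
  have [E1 E2 E3] := K y.
  exists (scons q (scons y (scons (opp y) t)), w); first by apply/cup_at1; exists y.
  apply: (proj2 (cross_at0 h f _ _ _ _ _ _)).
  by rewrite /crossed /= E1 E2 E3.
move=> /cup_at1[y ->] /cross_at0 ->; apply/sem_two.
have [E1 E2 E3] := K y.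
set x := cross_left h (crossing_change c) q y in E1 E2 E3 *.
exists (scons x (scons (opp x) (scons q t)), w); first by exists x.
by apply/cross_at1; rewrite /crossed /= E1 E2 E3.
Qed.

Lemma writhe_shift_left (h : Z) (f : Z -> Z) (b : bool) (x y : color) (t : kind) :
  writhe h f b (shift (jump h x.1 t) x) y = writhe h f b x (shift (- jump h y.1 t) y).
Proof.
rewrite -[RHS](writhe_shift _ _ _ _ _ t) /=.
by rewrite shiftD Z.add_opp_diag_r shift0.
Qed.

Lemma writhe_shift_right (h : Z) (f : Z -> Z) (b : bool) (x y : color) (t : kind) :
  writhe h f b (shift (- jump h x.1 t) x) (shift (- jump h y.1 t) y) =
  writhe h f b x y.
Proof.
rewrite -[LHS](writhe_shift _ _ _ _ _ t) /=.
by rewrite !shiftD !Z.add_opp_diag_r !shift0.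
Qed.

(** The shifts of one strand across two others commute, and a third strand shifts both labels at a
    crossing alike, so each crossing keeps its index. *)
Lemma sem_triangle (h : Z) (f : Z -> Z) (a b c : crossing) (C C' : config) :
  triangle a b c ->
  sem h f [:: (Cross a, 0); (Cross b, 1); (Cross c, 0)] C C' <->
  sem h f [:: (Cross c, 1); (Cross b, 0); (Cross a, 1)] C C'.
Proof.
case: C => s w T; have [x [y [s' ->]]] := state_cons2 s.
rewrite -(scons_stail s'); move: (s' 0) (stail s') => z t {s s'}.
rewrite (sem_det _ _ (cross_at0 h f a x y (scons z t) w)).
rewrite (sem_det _ _ (cross_at1 h f b _ _ z t _)).
rewrite (sem_det _ _ (cross_at0 h f c _ _ (scons _ t) _)).
rewrite (sem_det _ _ (cross_at1 h f c x y z t w)).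
rewrite (sem_det _ _ (cross_at0 h f b _ _ (scons _ t) _)).
rewrite (sem_det _ _ (cross_at1 h f a _ _ _ t _)).
rewrite /= /crossed /=; set L := (_, _); set R := (_, _).
suff -> : L = R by [].
rewrite /L /R {L R}; case: T => [a' b' c' _||c'|b'|a'] /=; rewrite ?addw0 //.
- congr pair.
    congr scons; first by rewrite !shiftD; congr shift; ring.
    congr scons; first by rewrite !shiftD; congr shift; ring.
    congr scons; first by rewrite !shiftD; congr shift; ring.
  rewrite writhe_shift writhe_shift_right writhe_shift_left.
  by rewrite /addw /=; congr pair; ring.
Qed.

Lemma sem_local_move (h : Z) (f : Z -> Z) (u v : seq slice) : f 0%Z = 0%Z ->
  local_move u v -> forall C C', sem h f u C C' <-> sem h f v C C'.
Proof.
move=> f0; case=> [p q i j|i|i|c i|c i|b i|i|b i|i|a b c i T] C C'.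
- have := sem_raise_iff i (sem_exchange h f p q j) C C'.
  by rewrite /raise /= addn0 !addnA.
- by have := sem_raise_iff i (sem_zigzag_left h f) C C';
  rewrite /raise /= addn0 ?addn1.
- by have := sem_raise_iff i (sem_zigzag_right h f) C C';
  rewrite /raise /= addn0 ?addn1.
- by have := sem_raise_iff i (sem_slide_cap h f c) C C';
  rewrite /raise /= addn0 ?addn1.
- by have := sem_raise_iff i (sem_slide_cup h f c) C C';
  rewrite /raise /= addn0 ?addn1.
- by have := sem_raise_iff i (fun C C' => @sem_RI h f (Classical b) C C' f0) C C';
  rewrite /raise /= addn0 ?addn1.
- by have := sem_raise_iff i (fun C C' => @sem_RI h f Virtual C C' f0) C C';
  rewrite /raise /= addn0 ?addn1.
- by have := sem_raise_iff i (sem_RII h f b) C C';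
  rewrite /raise /= addn0 ?addn1.
- by have := sem_raise_iff i (sem_VRII h f) C C';
  rewrite /raise /= addn0 ?addn1.
- by have := sem_raise_iff i (fun C C' => @sem_triangle h f a b c C C' T) C C';
  rewrite /raise /= addn0 ?addn1.
Qed.

Lemma sem_move (h : Z) (f : Z -> Z) (D E : diagram) (C C' : config) :
  f 0%Z = 0%Z -> move D E -> sem h f (word D) C C' <-> sem h f (word E) C C'.
Proof.
move=> f0 [below [above [u [v [M -> ->]]]]].
split=> /sem_cat[B H1 /sem_cat[B' H2 H3]]; apply/sem_cat; exists B => //;
  apply/sem_cat; exists B' => //; exact/(@sem_local_move h f u v f0 M).
Qed.

Lemma sem_equivalent (h : Z) (f : Z -> Z) (D E : diagram) (C C' : config) :
  f 0%Z = 0%Z -> equivalent D E -> sem h f (word D) C C' <-> sem h f (word E) C C'.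
Proof.
move=> f0; elim=> {D E} [D E M|D|D E _ IH|D E F _ IH1 _ IH2] //.
- exact: sem_move.
- by split=> /IH.
- by rewrite IH1.
Qed.

(** * Weights under virtualization and crossing change *)

Definition crossingless (w : seq slice) : bool :=
  all (fun s => if s.1 is Cross _ then false else true) w.

Lemma sem_crossingless (h : Z) (f : Z -> Z) (w : seq slice) (C C' : config) :
  crossingless w ->
  sem h f w C C' -> C'.2 = C.2.
Proof.
elim: w C => [|[p i] w IH] C /=; first by move=> _ ->.
move=> /andP[Hp /IH{}IH] [B H /IH->] {IH}.
elim: i C B H => [|i IH] C B /=; last by move=> [_ /IH].
by case: p Hp => // _ [x ->].
Qed.

Lemma crossingless_trivial (k : nat) : crossingless (trivial_word k).
Proof. by elim: k. Qed.

(** With [h = 0] and [f = zero] only orientations, sublinks and the span remain; this much survives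
    the virtualization of a self-crossing. *)
Definition unlabel (s : state) : state := fun j => ((s j).1, 0%Z).

Lemma unlabel_scons (x : color) (s : state) :
  unlabel (scons x s) = scons (x.1, 0%Z) (unlabel s).
Proof. by apply: funext; case. Qed.

Definition zero : Z -> Z := fun=> 0%Z.

Lemma step_unlabel (h : Z) (f : Z -> Z) (p : piece) (i : nat) (C C' : config)
    (a : Z) :
  right_of i (at_bottom h f p) C C' ->
  right_of i (at_bottom 0 zero p) (unlabel C.1, (a, 0%Z))
    (unlabel C'.1, (a + (C'.2.1 - C.2.1), 0)%Z).
Proof.
elim: i C C' => [|i IH] C C' /=; last first.
  by move=> [E /IH H]; split=> //; rewrite /unlabel E.
case: p => [[x ->]|[x ->]|c [x [y [s [w [-> ->]]]]]] /=.
- exists (x.1, 0%Z); rewrite !unlabel_scons Z.sub_diag Z.add_0_r.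
  by [].
- exists (x.1, 0%Z); rewrite !unlabel_scons Z.sub_diag Z.add_0_r.
  by [].
exists (x.1, 0%Z), (y.1, 0%Z), (unlabel s), (a, 0%Z).
rewrite !unlabel_scons; split=> //; congr pair.
  congr scons; first by case: c.
  by congr scons; case: c.
case: c => [b|] /=; rewrite /addw /=; congr pair.
- lia.
- by rewrite /writhe /zero Z.mul_0_r.
- lia.
Qed.

Lemma span_le (a b : kind) : (Z.abs (span a b) <= 1)%Z.
Proof. by case: a b => [[]|[]|] [[]|[]|]. Qed.

(* So a mixed crossing neither shifts labels nor contributes to the writhe.   *)
Lemma span_dir1 (a b : kind) : span a b <> 0%Z -> (dir1 a * dir1 b = 0)%Z.
Proof. by case: a b => [[]|[]|] [[]|[]|]. Qed.

(** Virtualizing suppresses the jumps of the labels. Constant labels are not affected; other labels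
    are kept where both jumps vanish, as at a crossing with nonzero span. *)
Lemma step_virtualize (h : Z) (f : Z -> Z) (b : bool) (i : nat) (C C' : config)
    (w : Z * Z) :
  right_of i (at_bottom h f (Cross (Classical b))) C C' ->
  (Z.abs (C'.2.1 - C.2.1) <= 1)%Z /\
  right_of i (at_bottom 0 zero (Cross Virtual)) (unlabel C.1, w) (unlabel C'.1, w) /\
  (C'.2.1 - C.2.1 <> 0 -> C'.2.2 = C.2.2 /\
   right_of i (at_bottom h f (Cross Virtual)) (C.1, w) (C'.1, w))%Z.
Proof.
elim: i C C' => [|i IH] C C' /=; last first.
  move=> [E /IH[H1 [H2 H3]]]; split=> //; split; first by rewrite {1 2}/unlabel E.
  by move=> /H3 [].
move=> [x [y [s [v [-> ->]]]]] /=.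
have -> : (v.1 + span x.1 y.1 - v.1 = span x.1 y.1)%Z by ring.
split; first exact: span_le.
split.
  exists (x.1, 0%Z), (y.1, 0%Z), (unlabel s), w.
  by rewrite !unlabel_scons addw0.
move=> /span_dir1 E.
rewrite /writhe /jump E Z.mul_0_r Z.mul_0_l Z.add_0_r; split=> //.
exists x, y, s, w; rewrite addw0 /=; split=> //.
have -> : (h * (dir1 y.1 * dir1 y.1) * dir1 x.1 = h * dir1 y.1 * (dir1 x.1 * dir1 y.1))%Z.
  ring.
have -> : (h * (dir1 x.1 * dir1 x.1) * dir1 y.1 = h * dir1 x.1 * (dir1 x.1 * dir1 y.1))%Z.
  ring.
by rewrite E !Z.mul_0_r !shift0.
Qed.

(** Jumps do not depend on which strand is over, so the colours persist. Sign and index are both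
    negated, so at a self-crossing of doubled index d the writhe changes by [f d + f (- d)] up to
    sign. *)
Lemma step_change (h : Z) (f : Z -> Z) (b : bool) (i : nat) (C C' : config)
    (w : Z * Z) :
  (forall d, Z.abs (f d + f (- d)) <= 1)%Z ->
  right_of i (at_bottom h f (Cross (Classical b))) C C' ->
  exists2 w', right_of i (at_bottom h f (Cross (Classical (~~ b)))) (C.1, w) (C'.1, w') &
    (w'.1 - w.1 = C'.2.1 - C.2.1 /\
     Z.abs ((C'.2.2 - C.2.2) - (w'.2 - w.2)) <= 1)%Z.
Proof.
move=> Hf; elim: i C C' => [|i IH] C C' /=; last first.
  by move=> [E /IH[w' H1 H2]]; exists w'.
move=> [x [y [s [v [-> ->]]]]] /=.
exists (addw w (weight h f (Classical (~~ b)) x y)); first by exists x, y, s, w.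
rewrite /=; split; first by ring.
rewrite /writhe; set g := gap h x y; have := Hf g.
have D : (Z.abs (dir1 x.1 * dir1 y.1) <= 1)%Z.
  by case: (x.1) (y.1) => [[]|[]|] [[]|[]|].
set d := (dir1 x.1 * dir1 y.1)%Z in D *.
have [->|[->|->]] : (d = 0 \/ d = 1 \/ d = -1)%Z by lia.
all: case: b; cbn [sgn negb]; rewrite (Z.mul_1_l g) (_ : -1 * g = - g)%Z; lia.
Qed.

(** Two conclusions are carried through the induction: an unlabelled colouring of [v], which always
    exists and bounds the loss of span, and a labelled one over the same states, available when the
    loss is extremal. *)
Lemma modified_weights (f : Z -> Z) (n m : nat) (u v : seq slice) :
  (forall d, Z.abs (f d + f (- d)) <= 1)%Z ->
  modified n m u v -> forall (C C' : config) (p' : Z) (q' : Z),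
  sem 1 f u C C' -> exists p1' : Z,
  [/\ sem 0 zero v (unlabel C.1, (p', 0%Z)) (unlabel C'.1, (p1', 0%Z)),
      (C'.2.1 - C.2.1 - (p1' - p') <= Z.of_nat n)%Z &
      (C'.2.1 - C.2.1 - (p1' - p') = Z.of_nat n)%Z ->
      exists2 q1' : Z, sem 1 f v (C.1, (p', q')) (C'.1, (p1', q1')) &
      (Z.abs (C'.2.2 - C.2.2 - (q1' - q')) <= Z.of_nat m)%Z].
Proof.
move=> Hf; elim=> {n m u v}
  [|n m s u v _ IH|n m b i u v _ IH|n m b i u v _ IH] C C' p' q' /=.
- move=> <-; exists p'; split=> //; first lia.
  by move=> _; exists q' => //; lia.
- move=> [B H1 H2].
  have [p1 [S1 S2 S3]] := IH B C' (p' + (B.2.1 - C.2.1))%Z (q' + (B.2.2 - C.2.2))%Z H2.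
  exists p1; split.
  + exists (unlabel B.1, (p' + (B.2.1 - C.2.1), 0)%Z) => //; exact: step_unlabel H1.
  + lia.
  move=> E; have [q1 T1 T2]  := S3 ltac:(lia).
  exists q1; last lia.
  exists (B.1, (p' + (B.2.1 - C.2.1), q' + (B.2.2 - C.2.2))%Z) => //.
  case: C B H1 {IH S1 S2 S3 H2 T1 T2 E} => s0 w0 [s1 w1] H1 /=.
  have /= := right_of_addw (p' - w0.1, q' - w0.2)%Z H1.
  rewrite /addw /= => H; congr (right_of _ _ _ _): H; congr (pair _ (pair _ _)); lia.
- move=> [B H1 H2].
  have [K1 [K2 K3]] := step_virtualize (p', 0%Z) H1.
  have [p1 [S1 S2 S3]] := IH B C' p' q' H2.
  exists p1; split.
  + by exists (unlabel B.1, (p', 0%Z)).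
  + lia.
  (* A total loss of n + 1, of which the later slices account for at most n, forces a loss of 1
     here: the crossing is mixed. *)
  move=> E; have [q1 T1 T2]  := S3 ltac:(lia).
  have [_ [_ /(_ ltac:(lia))[K4 K5]]] := step_virtualize (p', q') H1.
  exists q1; last lia.
  by exists (B.1, (p', q')).
move=> [B H1 H2].
have [w' K1 [K2 K3]] := step_change (p', q') Hf H1.
have [w'' K1' [K2' K3']] := step_change (p', 0%Z) Hf H1.
have [p1 [S1 S2 S3]] := IH B C' w'.1 w'.2 H2.
exists p1; split.
- exists (unlabel B.1, (w'.1, 0%Z)) => //.
  have := step_unlabel p' K1'.
  rewrite /= in K2 K2' K3' *; rewrite K2' (_ : _ + _ = w'.1)%Z //; lia.
- move: K2 => /=; lia.
have {}K2 : (w'.1 - p' = B.2.1 - C.2.1)%Z := K2.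
have {}K3 := K3 : (Z.abs (B.2.2 - C.2.2 - (w'.2 - q')) <= 1)%Z.
move=> E; have [q1 T1 T2] := S3 ltac:(lia).
exists q1; last by move: K3 => /=; lia.
by exists (B.1, w') => //; case: (w') T1.
Qed.

(** * Twists, clasps and the example diagrams *)

Definition repeat (n : nat) (w : seq slice) : seq slice := flatten (nseq n w).

(** The virtual crossing puts both strands back in place, so a twist acts on labels and weight
    only. *)
Definition twist (c : crossing) (i : nat) : seq slice :=
  [:: (Cross c, i); (Cross Virtual, i)].
Definition clasp (b : bool) (i : nat) : seq slice :=
  [:: (Cross (Classical false), i); (Cross (Classical b), i)].

Lemma repeatS (n : nat) (w : seq slice) : repeat n.+1 w = w ++ repeat n w.
Proof. by []. Qed.

Lemma raise_repeat (i n : nat) (w : seq slice) :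
  raise i (repeat n w) = repeat n (raise i w).
Proof. by elim: n => // n IH; rewrite !repeatS -IH /raise map_cat. Qed.

Lemma raise_twist (c : crossing) (i : nat) : twist c i = raise i (twist c 0).
Proof. by rewrite /raise /= addn0. Qed.

Lemma raise_clasp (b : bool) (i : nat) : clasp b i = raise i (clasp b 0).
Proof. by rewrite /raise /= addn0. Qed.

Lemma sem_cons (h : Z) (f : Z -> Z) (s : slice) (w : seq slice) (C C' : config) :
  sem h f (s :: w) C C' <->
  exists2 B, right_of s.2 (at_bottom h f s.1) C B & sem h f w B C'.
Proof. by []. Qed.

Lemma sem_raise1 (h : Z) (f : Z -> Z) (w : seq slice) (a : color) (s : state)
    (v : Z * Z) (C : config) :
  sem h f (raise 1 w) (scons a s, v) C <->
  exists2 B, sem h f w (s, v) B & C = (scons a B.1, B.2).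
Proof.
case: C => t z; split=> [/sem_raise [E H]|[[t' z'] H [-> ->]]].
  by exists (stail t, z) => //; congr pair; apply: state_eq.
by apply/sem_raise; split.
Qed.

Lemma sem_twist (f : Z -> Z) (b : bool) (n : nat) (x y : color) (s : state)
    (w : Z * Z) (C : config) :
  sem 1 f (twist (Classical b) 0 ++ repeat n (twist (Classical b) 0))
    (scons x (scons y s), w) C <->
  sem 1 f (repeat n (twist (Classical b) 0))
    (scons (shift (jump 1 x.1 y.1) x) (scons (shift (- jump 1 y.1 x.1) y) s),
     addw w (weight 1 f (Classical b) x y)) C.
Proof.
rewrite cat_cons (sem_det _ _ (cross_at0 1 f (Classical b) x y s w)).
by rewrite cat_cons (sem_det _ _ (cross_at0 1 f Virtual _ _ s _)) /= /crossed /= addw0.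
Qed.

Lemma sem_twists (f : Z -> Z) (b : bool) (n : nat) (x y : color) (s : state)
    (w : Z * Z) (C : config) :
  sem 1 f (repeat n (twist (Classical b) 0)) (scons x (scons y s), w) C ->
  exists x' y' q, [/\ x'.1 = x.1, y'.1 = y.1 &
    C = (scons x' (scons y' s), (w.1 + Z.of_nat n * span x.1 y.1, q)%Z)].
Proof.
elim: n x y w => [|n IH] x y w.
  by move=> <-; exists x, y, w.2; case: w => p q; rewrite /= Z.mul_0_l Z.add_0_r.
move=> /sem_twist /IH[x' [y' [q [E1 E2 ->]]]]; exists x', y', q; split=> //.
congr (_, (_, _)); rewrite /=; lia.
Qed.

Lemma sem_twists_mixed (f : Z -> Z) (b : bool) (n : nat) (x y : color) (s : state)
    (w : Z * Z) (C : config) : (dir1 x.1 * dir1 y.1 = 0)%Z ->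
  sem 1 f (repeat n (twist (Classical b) 0)) (scons x (scons y s), w) C <->
  C = (scons x (scons y s), (w.1 + Z.of_nat n * span x.1 y.1, w.2)%Z).
Proof.
move=> E; elim: n w => [|n IH] w.
  by case: w => p q; rewrite /= Z.mul_0_l Z.add_0_r; split.
rewrite repeatS sem_twist.
have -> : jump 1 x.1 y.1 = 0%Z.
  transitivity (dir1 x.1 * (dir1 x.1 * dir1 y.1))%Z; first by rewrite /jump; ring.
  by rewrite E; ring.
have -> : jump 1 y.1 x.1 = 0%Z.
  transitivity (dir1 y.1 * (dir1 x.1 * dir1 y.1))%Z; first by rewrite /jump; ring.
  by rewrite E; ring.
rewrite !shift0 IH /= /writhe E.
suff -> : (w.1 + span x.1 y.1 + Z.of_nat n * span x.1 y.1,
           w.2 + sgn b * 0 * f (sgn b * gap 1 x y))%Z =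
          (w.1 + Z.of_nat n.+1 * span x.1 y.1, w.2)%Z by [].
congr pair; lia.
Qed.

Lemma span_reverse (a : kind) : span a (reverse a) = 0%Z.
Proof. rewrite /span dir1_reverse dir2_reverse; ring. Qed.

Lemma reverse_span (a : kind) : span (reverse a) a = 0%Z.
Proof. rewrite /span dir1_reverse dir2_reverse; ring. Qed.

(** Both labels shift by the same amount, so their difference, and with it the index, is the same at
    every twist. *)
Lemma sem_twists_antiparallel (f : Z -> Z) (b : bool) (n : nat) (k : kind)
    (i j : Z) (s : state) (p q : Z) (C : config) :
  sem 1 f (repeat n (twist (Classical b) 0))
    (scons (k, i) (scons (reverse k, j) s), (p, q)) C <->
  C = (scons (k, i - Z.of_nat n * dir1 k)%Z
        (scons (reverse k, j - Z.of_nat n * dir1 k)%Z s),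
       (p, q + Z.of_nat n * writhe 1 f b (k, i) (reverse k, j))%Z).
Proof.
elim: n i j q => [|n IH] i j q.
  by rewrite /= !Z.mul_0_l !Z.sub_0_r Z.add_0_r; split.
rewrite repeatS sem_twist /addw /= rev_jump jump_rev /jump Z.mul_1_l dir1_cube.
rewrite /shift /= span_reverse Z.add_0_r IH.
suff -> : writhe 1 f b (k, i + - dir1 k)%Z (reverse k, j + - dir1 k)%Z =
          writhe 1 f b (k, i) (reverse k, j).
  have S a : (a + - dir1 k - Z.of_nat n * dir1 k = a - Z.of_nat n.+1 * dir1 k)%Z by lia.
  rewrite !S; set W := writhe _ _ _ _ _.
  by have -> : (q + W + Z.of_nat n * W = q + Z.of_nat n.+1 * W)%Z by lia.
by rewrite /writhe /gap /= (_ : i + - dir1 k - (j + - dir1 k) = i - j)%Z //; ring.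
Qed.

(** The second crossing undoes the label shifts of the first; the two have the same sign and
    opposite indices. *)
Lemma sem_clasps (f : Z -> Z) (n : nat) (k : kind) (i j : Z) (s : state)
    (p q : Z) (C : config) :
  sem 1 f (repeat n (clasp false 0)) (scons (k, i) (scons (reverse k, j) s), (p, q)) C <->
  C = (scons (k, i) (scons (reverse k, j) s),
       (p, q + Z.of_nat n * (dir1 k * dir1 k *
          (f (2 * (i - j)) + f (- (2 * (i - j))))))%Z).
Proof.
elim: n q => [|n IH] q.
  by rewrite /= Z.mul_0_l Z.add_0_r; split.
rewrite repeatS !cat_cons cat0s.
rewrite (sem_det _ _ (cross_at0 1 f (Classical false) _ _ s _)).
rewrite (sem_det _ _ (cross_at0 1 f (Classical false) _ _ s _)).
rewrite /crossed /= !rev_jump !jump_rev /shift /= Z.opp_involutive.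
rewrite (_ : i + - jump 1 k k + jump 1 k k = i)%Z; last by ring.
rewrite (_ : j + - jump 1 k k + jump 1 k k = j)%Z; last by ring.
rewrite /addw /= span_reverse reverse_span !Z.add_0_r IH.
set W := (_ * (_ + _))%Z; set q' := (q + _ + _)%Z.
suff -> : q' = (q + W)%Z.
  by have -> : (q + W + Z.of_nat n * W = q + Z.of_nat n.+1 * W)%Z by lia.
have Jk : jump 1 k k = dir1 k by rewrite /jump Z.mul_1_l dir1_cube.
rewrite /q' /W /writhe /gap /= !dir1_reverse Jk.
set X := f _; set Y := f _; set X' := f _; set Y' := f _.
have -> : X = Y' by rewrite /X /Y'; congr f; ring.
have -> : Y = X' by rewrite /Y /X'; congr f; ring.
ring.
Qed.

Lemma cap_at2 (h : Z) (f : Z -> Z) (a b x y : color) (s : state) (w : Z * Z)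
    (C : config) :
  right_of 2 (at_bottom h f Cap) (scons a (scons b (scons x (scons y s))), w) C <->
  y = opp x /\ C = (scons a (scons b s), w).
Proof.
case: C => t v; split=> [[E /(@cap_at1 h f b x y s w)[-> [F ->]]]|[-> [-> ->]]].
  by split=> //; congr pair; apply: state_eq.
by split=> //; apply/cap_at1.
Qed.

Lemma cup_at2 (h : Z) (f : Z -> Z) (a b : color) (s : state) (w : Z * Z)
    (C : config) :
  right_of 2 (at_bottom h f Cup) (scons a (scons b s), w) C <->
  exists x, C = (scons a (scons b (scons x (scons (opp x) s))), w).
Proof.
case: C => t v; split=> [[E /(@cup_at1 h f b s w)[x [F ->]]]|[x [-> ->]]].
  by exists x; congr pair; apply: state_eq.
by split=> //; apply/cup_at1; exists x.
Qed.

(** An arc and a circle tangled by n twists; the two ends of the arc are left open for [knot]. *)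
Definition chain (n : nat) (c : crossing) : seq slice :=
  [:: (Cup, 0); (Cup, 2)] ++ repeat n (twist c 1) ++ [:: (Cap, 2)].

(* With b = false the clasps are full twists, with b = true they are trivial. *)
(* The twists shift by r the labels of the first two of the four strands of   *)
(* the knot, so that the crossings of the clasps have indices r and -r.       *)
Definition knot (m r : nat) (b : bool) : seq slice :=
  [:: (Cup, 1)] ++ repeat r (twist (Classical true) 0) ++ repeat m (clasp b 1)
  ++ [:: (Cap, 0); (Cap, 0)].

Definition pattern (n m r k : nat) (c : crossing) (b : bool) : seq slice :=
  chain n c ++ knot m r b ++ trivial_word k.

(** The caps force equal labels on the antiparallel strands that enter the twists, so the twists
    have index 0 and contribute nothing to the writhe; they only separate the labels that the clasps
    compare. *)
Lemma sem_knot (f : Z -> Z) (m r : nat) (a : kind) (i : Z) (y : color) (s : state)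
    (p q : Z) (C : config) : f 0%Z = 0%Z ->
  sem 1 f (knot m r false) (scons (a, i) (scons y s), (p, q)) C <->
  y = opp (a, i) /\ C = (s, (p, q + Z.of_nat m * (dir1 a * dir1 a *
     (f (- (2 * (Z.of_nat r * dir1 a))) + f (2 * (Z.of_nat r * dir1 a)))))%Z).
Proof.
move=> f0; set tw := repeat r (twist (Classical true) 0).
pose W := (Z.of_nat r * dir1 a)%Z.
have Ecl : repeat m (clasp false 1) = raise 1 (repeat m (clasp false 0)).
  by rewrite raise_repeat -raise_clasp.
have Q : (q + Z.of_nat r * writhe 1 f true (a, i) (reverse a, i) +
    Z.of_nat m * (dir1 (reverse a) * dir1 (reverse a) *
      (f (2 * (i - W - i)) + f (- (2 * (i - W - i))))) =
    q + Z.of_nat m * (dir1 a * dir1 a * (f (- (2 * W)) + f (2 * W))))%Z.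
  rewrite /writhe /gap /= dir1_reverse Z.sub_diag Z.add_opp_diag_r.
  rewrite (_ : 2 * (i - W - i) = - (2 * W))%Z; last by ring.
  rewrite Z.opp_involutive !Z.mul_0_r f0; ring.
have clasps v : sem 1 f (repeat m (clasp false 1))
    (scons (a, i - W)%Z (scons (reverse a, i - W)%Z (scons (a, i) (scons y s))), (p, v))
    (scons (a, i - W)%Z (scons (reverse a, i - W)%Z (scons (a, i) (scons y s))),
     (p, v + Z.of_nat m * (dir1 (reverse a) * dir1 (reverse a) *
      (f (2 * (i - W - i)) + f (- (2 * (i - W - i))))))%Z).
  have := (sem_clasps f m (reverse a) (i - W) i (scons y s) p v _).2 erefl.
  by rewrite Ecl reverseK => H; apply/sem_raise1; eexists; first exact: H.
split.
  move=> /sem_cons[B /cup_at1[[k j] ->] /sem_cat[B1 H1 H2]].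
  have [x' [y' [q1 [Ex Ey E1]]]] := sem_twists H1.
  (* Twists and clasps preserve kinds, so the first cap already determines the kind of the cup. *)
  have Ek : k = reverse a.
    move: H2; rewrite E1 => /sem_cat[B2].
    have -> : y' = (k, y'.2) by case: (y') Ey => k' j' /= ->.
    rewrite Ecl => /sem_raise1[B3].
    move=> /sem_clasps -> -> /sem_two[B4 /cap_at0[[E _] _] _].
    by rewrite E Ex.
  subst k; move: H1 H2 => /sem_twists_antiparallel -> {B1 E1} /sem_cat[B1].
  rewrite Ecl => /sem_raise1[B2] /sem_clasps -> ->.
  move=> /sem_two[B3 /cap_at0[[Ej] ->] /cap_at0[-> ->]].
  have {}Ej : j = i by lia.
  by subst j; rewrite /opp /= reverseK -/W Q.
move=> [Ey ->]; subst y; apply/sem_cons.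
exists (scons (a, i) (scons (reverse a, i) (scons (a, i) (scons (opp (a, i)) s))),
  (p, q)).
  by apply/cup_at1; exists (reverse a, i); rewrite /opp /= reverseK.
apply/sem_cat; eexists; first exact/sem_twists_antiparallel.
apply/sem_cat; eexists; first exact: clasps.
apply/sem_two; eexists; first by apply/cap_at0; split=> //; reflexivity.
apply/cap_at0; split=> //.
by rewrite -Q.
Qed.

(** Here [z] is the kind of the circle. If arc and circle both lie in the first sublink, the twists
    are self-crossings and may move labels and writhe; hence the condition in the last clause. *)
Lemma sem_chain (f : Z -> Z) (n : nat) (s : state) (p q : Z) (C : config) :
  sem 1 f (chain n (Classical true)) (s, (p, q)) C -> exists x y z q',
  [/\ y.1 = reverse x.1, C = (scons x (scons y s), (p + Z.of_nat n * span y.1 z, q')%Z) &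
     (dir1 y.1 * dir1 z = 0)%Z -> q' = q /\ y = opp x].
Proof.
move=> /sem_cons[B [x ->] /sem_cons[B' /cup_at2[z ->] /sem_cat[B1]]].
rewrite (raise_twist _ 1) -raise_repeat => /sem_raise1[B2 H ->].
have [y [z' [q' [Ey Ez E]]]] := sem_twists H.
move: H; rewrite E => H /sem_cons[B3 /cap_at2[Ezz ->]] <- {B B' B1 B2 B3 E}.
exists x, y, z.1, q'; rewrite Ey; split=> //= D.
move: H => /(@sem_twists_mixed f true n (opp x) z _ _ _ D) E.
by split; [have := congr1 (fun C => C.2.2) E | have := congr1 (fun C => C.1 0) E].
Qed.

Lemma chain_sem (f : Z -> Z) (n : nat) (x y : color) (s : state) (p q : Z) :
  (dir1 x.1 * dir1 y.1 = 0)%Z ->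
  sem 1 f (chain n (Classical true)) (s, (p, q))
   (scons x (scons (opp x) s), (p + Z.of_nat n * span (reverse x.1) y.1, q)%Z).
Proof.
move=> D; apply/sem_cons; exists (scons x (scons (opp x) s), (p, q)); first by exists x.
apply/sem_cons; exists (scons x (scons (opp x) (scons y (scons (opp y) s))), (p, q)).
  by apply/cup_at2; exists y.
apply/sem_cat.
exists (scons x (scons (opp x) (scons y (scons (opp y) s))),
  (p + Z.of_nat n * span (reverse x.1) y.1, q)%Z).
  rewrite (raise_twist _ 1) -raise_repeat; apply/sem_raise1; eexists.
    by apply/sem_twists_mixed; rewrite //= dir1_reverse; lia.
  by [].
by apply/sem_cons; eexists; first exact/cap_at2.
Qed.

(** * The colouring that attains the bound *)

Definition indicator (d e : Z) : Z := if Z.eqb e d then 1%Z else 0%Z.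

Lemma indicator_eq (d e : Z) : e = d -> indicator d e = 1%Z.
Proof. by move=> ->; rewrite /indicator Z.eqb_refl. Qed.

Lemma indicator_neq (d e : Z) : e <> d -> indicator d e = 0%Z.
Proof. by move=> /Z.eqb_neq E; rewrite /indicator E. Qed.

(** Since d is nonzero, e and -e cannot both equal d; this gives the bound on [f] required by
    [step_change]. *)
Lemma indicator_sum (d e : Z) : d <> 0%Z ->
  (0 <= indicator d e + indicator d (- e) <= 1)%Z.
Proof.
rewrite /indicator.
by case: (Z.eqb_spec e d) (Z.eqb_spec (- e) d) => [->|_] [E|_]; lia.
Qed.

Definition start : config := (fun=> blank, (0, 0)%Z).
Definition target (p q : Z) : config := (fun=> blank, (p, q)).

Lemma sem_trivial_word (h : Z) (f : Z -> Z) (k : nat) (C : config) :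
  sem h f (trivial_word k) C C.
Proof.
case: C => s w; elim: k => //= k IH.
exists (scons blank (scons blank s), w); first by exists blank.
by exists (s, w) => //; exists blank.
Qed.

Lemma pattern_sem (n m r k : nat) : 0 < r ->
  sem 1 (indicator (2 * Z.of_nat r)) (pattern n m r k (Classical true) false) start
    (target (Z.of_nat n) (Z.of_nat m)).
Proof.
move=> /ltP r0; apply/sem_cat; eexists.
  (* The twists involve the right end of the cup, of kind [First true], so each of them has span
     1. *)
  exact: (@chain_sem _ n (First false, 0%Z) (Second true, 0%Z)).
apply/sem_cat; eexists; last exact: sem_trivial_word.
apply/sem_knot; first by rewrite indicator_neq //; lia.
split=> //; congr (_, (_, _)); first by rewrite /span /=; lia.
rewrite indicator_eq ?indicator_neq; rewrite /=; lia.
Qed.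

(** A nonzero span puts arc and circle in different sublinks, so the chain adds no writhe. All of
    [q] then comes from the clasps, whose doubled indices are 2r' and -2r'. *)
Lemma sem_pattern_indicator (n m r r' k : nat) (s s' : state) (q : Z) :
  0 < n -> 0 < r -> 0 < r' ->
  sem 1 (indicator (2 * Z.of_nat r)) (pattern n m r' k (Classical true) false)
    (s, (0, 0)%Z) (s', (Z.of_nat n, q)) ->
  q <> 0%Z -> r = r'.
Proof.
move=> /ltP n0 /ltP r0 /ltP r0' /sem_cat[B /sem_chain[[a i] [y [z [q' [Ey -> Eq]]]]]].
move=> /sem_cat[B' /sem_knot[|E ->]].
  by rewrite indicator_neq //; lia.
move=> /(sem_crossingless (crossingless_trivial k)) [E1 E2] q0.
have {}Eq : q' = 0%Z.
  have [] // := Eq; apply: span_dir1 => S; move: E1; rewrite S; lia.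
move: E2 q0; rewrite Eq /= => -> q0.
suff [E2|E2] : (2 * (Z.of_nat r' * dir1 a) = 2 * Z.of_nat r \/
              - (2 * (Z.of_nat r' * dir1 a)) = 2 * Z.of_nat r)%Z.
- by case: a {Ey E E1 Eq q0} E2 => [[]|[]|] /=; lia.
- by case: a {Ey E E1 Eq q0} E2 => [[]|[]|] /=; lia.
move: q0; rewrite /indicator; case: (Z.eqb_spec (2 * _)); first by left.
case: (Z.eqb_spec (- _)); first by right.
move=> _ _; lia.
Qed.

(** * Unknotting the examples *)

Definition reduces (u v : seq slice) : Prop :=
  forall (D : diagram) (below above : seq slice), word D = below ++ u ++ above ->
  exists2 E : diagram, word E = below ++ v ++ above & equivalent D E.

Lemma reduces_refl (u : seq slice) : reduces u u.
Proof. by move=> D b a E; exists D => //; apply: rst_refl. Qed.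
Arguments reduces_refl u : clear implicits.

Lemma reduces_trans (u v w : seq slice) : reduces u v -> reduces v w -> reduces u w.
Proof.
move=> H K D b a /H[E /K[F EF H2] H1]; exists F => //.
exact: rst_trans H1 H2.
Qed.

Lemma reduces_cat (u u' v v' : seq slice) :
  reduces u u' -> reduces v v' -> reduces (u ++ v) (u' ++ v').
Proof.
move=> H K D b a; rewrite -catA => /H[E]; rewrite !catA -catA => /K[F EF H2] H1.
by exists F; [rewrite EF !catA | exact: rst_trans H1 H2].
Qed.

Lemma reduces_repeat (n : nat) (u : seq slice) :
  reduces u [::] -> reduces (repeat n u) [::].
Proof.
move=> H; elim: n => [|n IH]; first exact: reduces_refl.
exact: reduces_cat H IH.
Qed.

Lemma stack_None (w : seq slice) : foldl stack None w = None.
Proof. by elim: w. Qed.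

(** The second hypothesis makes [v] fit wherever [u] does, so that the rewritten word is again a
    diagram. *)
Lemma reduces_local (u v : seq slice) : local_move u v ->
  (forall c, foldl stack (Some c) u = None \/
             foldl stack (Some c) v = foldl stack (Some c) u) ->
  reduces u v.
Proof.
move=> M F D b a E.
have H : is_diagram (b ++ v ++ a).
  have := svalP D; rewrite /= -/(word D) E /is_diagram /strands_after !foldl_cat.
  case: (foldl stack (Some 0) b) => [c|]; last by rewrite !stack_None.
  by case: (F c) => ->; first rewrite stack_None.
exists (exist (fun w => is_diagram w : Prop) _ H) => //; apply: rst_step.
by exists b, a, u, v.
Qed.

Lemma stack_cross (n i : nat) (c : crossing) :
  stack (Some n) (Cross c, i) = if i + 2 <= n then Some n else None.
Proof.
rewrite /=; case: leqP => // H; rewrite subnK //.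
exact: leq_trans (leq_addl _ _) H.
Qed.

Lemma stack_cup (n i : nat) :
  stack (Some n) (Cup, i) = if i <= n then Some n.+2 else None.
Proof. by rewrite /= addn0 subn0 addn2. Qed.

Lemma stack_cap (n i : nat) :
  stack (Some n) (Cap, i) = if i + 2 <= n then Some n.-2 else None.
Proof. by rewrite /= addn0 subn2. Qed.

(** The blocks concerned need at most three strands below them, so 0, 1, 2 and c + 3 strands cover
    all cases. *)
Ltac fits := let c := fresh in
  move=> c; case: c => [|[|[|c]]];
  cbn [foldl];
  do 3 (rewrite ?(stack_cross, stack_cup, stack_cap); cbn [leq addn subn predn]);
  by [left | right].

Lemma reduces_virtual_twist : reduces (twist Virtual 1) [::].
Proof. apply: (reduces_local (VRII 1)); fits. Qed.

Lemma reduces_clasp : reduces (clasp true 1) [::].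
Proof. apply: (reduces_local (RII false 1)); fits. Qed.

(** Just below a cap, a twist is removed by a virtual and then a classical first move. *)
Lemma reduces_twists (b : bool) (r : nat) :
  reduces (repeat r (twist (Classical b) 0) ++ [:: (Cap, 0)]) [:: (Cap, 0)].
Proof.
elim: r => [|r IH]; first exact: reduces_refl.
rewrite repeatS -catA; apply: (reduces_trans (reduces_cat (reduces_refl _) IH)).
apply: (@reduces_trans _ ([:: (Cross (Classical b), 0)] ++ [:: (Cap, 0)])).
  apply: (@reduces_cat [:: (Cross (Classical b), 0)] [:: (Cross (Classical b), 0)]
    [:: (Cross Virtual, 0); (Cap, 0)] [:: (Cap, 0)] (reduces_refl _)).
  apply: (reduces_local (VRI 0)); fits.
apply: (reduces_local (RI b 0)); fits.
Qed.

(** Virtual second moves remove the twists; two exchanges of heights then bring the circle below the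
    arc. *)
Lemma reduces_chain (n : nat) :
  reduces (chain n Virtual) [:: (Cup, 0); (Cap, 0); (Cup, 0)].
Proof.
apply: (@reduces_trans _ [:: (Cup, 0); (Cup, 2); (Cap, 2)]).
  apply: (reduces_cat (reduces_refl [:: (Cup, 0); (Cup, 2)])).
  rewrite -[X in reduces _ X]cat0s; apply: (fun H => reduces_cat H (reduces_refl _)).
  exact: reduces_repeat reduces_virtual_twist.
apply: (@reduces_trans _ [:: (Cup, 0); (Cup, 0); (Cap, 2)]).
  apply: (@reduces_cat [:: (Cup, 0); (Cup, 2)] [:: (Cup, 0); (Cup, 0)]);
    last exact: reduces_refl.
  apply: (reduces_local (isotopy_exchange Cup Cup 0 0)); fits.
apply: (@reduces_cat [:: (Cup, 0)] [:: (Cup, 0)]); first exact: reduces_refl.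
apply: (reduces_local (isotopy_exchange Cup Cap 0 0)); fits.
Qed.

(** The clasps are second Reidemeister pairs; without them the twists vanish under the first cap and
    a zigzag remains. *)
Lemma reduces_knot (m r : nat) : reduces (knot m r true) [:: (Cap, 0)].
Proof.
apply: (@reduces_trans _ ([:: (Cup, 1)] ++ [:: (Cap, 0); (Cap, 0)])).
  apply: (reduces_cat (reduces_refl _)).
  apply: (@reduces_trans _
    ((repeat r (twist (Classical true) 0) ++ [:: (Cap, 0)]) ++ [:: (Cap, 0)])).
    rewrite -catA; apply: (reduces_cat (reduces_refl _)).
    rewrite -[X in reduces _ X]cat0s; apply: (fun H => reduces_cat H (reduces_refl _)).
    exact: reduces_repeat reduces_clasp.
  exact: reduces_cat (@reduces_twists _ _) (reduces_refl _).
apply: (@reduces_cat [:: (Cup, 1); (Cap, 0)] [::]); last exact: reduces_refl.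
apply: (reduces_local (isotopy_zigzag_right 0)); fits.
Qed.

Lemma strands_repeat (n c : nat) (w : seq slice) :
  foldl stack (Some c) w = Some c -> foldl stack (Some c) (repeat n w) = Some c.
Proof. by move=> H; elim: n => // n IH; rewrite repeatS foldl_cat H. Qed.

Lemma pattern_is_diagram (n m r k : nat) (c : crossing) (b : bool) :
  is_diagram (pattern n m r k c b).
Proof.
rewrite /is_diagram /strands_after /pattern /chain /knot !foldl_cat /=.
by rewrite !strands_repeat //=; apply: trivial_word_is_diagram.
Qed.

Lemma modified_cat (n n' m m' : nat) (u u' v v' : seq slice) :
  modified n m u v -> modified n' m' u' v' ->
  modified (n + n') (m + m') (u ++ u') (v ++ v').
Proof. by move=> H H'; elim: H => //= *; constructor. Qed.

Lemma modified_refl (u : seq slice) : modified 0 0 u u.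
Proof. by elim: u => *; constructor. Qed.

Lemma modified_repeat (n n' m' : nat) (u v : seq slice) :
  modified n' m' u v -> modified (n * n') (n * m') (repeat n u) (repeat n v).
Proof.
move=> H; elim: n => [|n IH]; first exact: modified_refl.
by rewrite !mulSn !repeatS; apply: modified_cat.
Qed.

Lemma modified_pattern (n m r k : nat) :
  modified n m (pattern n m r k (Classical true) false) (pattern n m r k Virtual true).
Proof.
have T : modified 1 0 (twist (Classical true) 1) (twist Virtual 1).
  by apply: modified_virtualize; apply: modified_refl.
have K : modified 0 1 (clasp false 1) (clasp true 1).
  by apply: modified_keep; apply: (@modified_change 0 0 false 1 _ _ modified_nil).
have := modified_cat
  (modified_cat (modified_refl [:: (Cup, 0); (Cup, 2)])
    (modified_cat (modified_repeat n T) (modified_refl [:: (Cap, 2)])))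
  (modified_cat (modified_cat (modified_refl [:: (Cup, 1)])
    (modified_cat (modified_refl (repeat r (twist (Classical true) 0)))
      (modified_cat (modified_repeat m K) (modified_refl [:: (Cap, 0); (Cap, 0)]))))
    (modified_refl (trivial_word k))).
by rewrite !muln0 !muln1 !addn0 !add0n.
Qed.

Definition pattern_diagram (n m r k : nat) (c : crossing) (b : bool) : diagram :=
  exist _ (pattern n m r k c b) (pattern_is_diagram n m r k c b).

Lemma pattern_trivial (n m r k : nat) :
  equivalent (pattern_diagram n m r k Virtual true) (trivial_diagram k.+2).
Proof.
have R := reduces_cat (@reduces_chain n)
  (reduces_cat (@reduces_knot m r) (reduces_refl (trivial_word k))).
have [|E EE H] := R (pattern_diagram n m r k Virtual true) [::] [::].
  by rewrite cats0.
suff -> : trivial_diagram k.+2 = E by [].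
by apply: val_inj; rewrite /= -[sval E]/(word E) EE cats0.
Qed.

(** * Counting components *)

Lemma n_comp_image (T : finType) (e : rel T) (f : T -> nat) (s : seq nat) :
  symmetric e -> uniq s -> (forall x, f x \in s) ->
  (forall c, c \in s -> exists x, f x = c) ->
  (forall x y, connect e x y = (f x == f y)) -> n_comp e predT = size s.
Proof.
move=> e_sym us fs sf fe; have ce : connect_sym e by move=> x y; rewrite !fe eq_sym.
rewrite /n_comp_mem cardE -(size_map f); apply/perm_size/uniq_perm => //.
  rewrite map_inj_in_uniq ?enum_uniq // => x y.
  rewrite !mem_enum !inE !andbT => /eqP rx /eqP ry E.
  by rewrite -rx -ry; apply/(rootP ce); rewrite fe E.
move=> c; apply/mapP/idP => [[x _ ->] //|/sf[x <-]].
exists (root e x); first by rewrite mem_enum !inE andbT roots_root.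
by apply/eqP; rewrite -fe connect_root.
Qed.

(* Strands are labelled by the height at which they are born.                 *)
Definition relabel (c : nat) (s : slice) (L : seq nat) : seq nat :=
  take s.2 L ++ (match s.1 with
                 | Cup => [:: c; c]
                 | Cap => [::]
                 | Cross _ => [:: nth 0 L s.2.+1; nth 0 L s.2]
                 end) ++ drop (s.2 + inputs s.1) L.

Fixpoint labels (c : nat) (L : seq nat) (w : seq slice) : seq nat :=
  if w is s :: w' then labels c.+1 (relabel c s L) w' else L.

Fixpoint births (c : nat) (w : seq slice) : seq nat :=
  if w is s :: w' then
    (if s.1 is Cup then [:: c] else [::]) ++ births c.+1 w'
  else [::].

(** Only the arc of a cap can join two different labels, so components are births modulo these
    pairs. *)
Fixpoint links (c : nat) (L : seq nat) (w : seq slice) : seq (nat * nat) :=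
  if w is s :: w' then
    (if s.1 is Cap then [:: (nth 0 L s.2, nth 0 L s.2.+1)] else [::])
    ++ links c.+1 (relabel c s L) w'
  else [::].

Lemma labels_cat (c : nat) (L : seq nat) (u v : seq slice) :
  labels c L (u ++ v) = labels (c + size u) (labels c L u) v.
Proof. by elim: u c L => [|s u IH] c L /=; rewrite ?addn0 // IH addSnnS. Qed.

Lemma births_cat (c : nat) (u v : seq slice) :
  births c (u ++ v) = births c u ++ births (c + size u) v.
Proof. by elim: u c => [|s u IH] c /=; rewrite ?addn0 // IH addSnnS catA. Qed.

Lemma links_cat (c : nat) (L : seq nat) (u v : seq slice) :
  links c L (u ++ v) = links c L u ++ links (c + size u) (labels c L u) v.
Proof. by elim: u c L => [|s u IH] c L /=; rewrite ?addn0 // IH addSnnS catA. Qed.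

Lemma birthsP (w : seq slice) (c l : nat) :
  reflect (c <= l < c + size w /\ (nth (Cup, 0) w (l - c)).1 = Cup) (l \in births c w).
Proof.
elim: w c => [|s w IH] c /=.
  by apply: (iffP idP) => // -[]; rewrite addn0; case: ltngtP.
rewrite mem_cat; have [E|cl] := altP (l =P c).
  subst c; rewrite subnn leqnn addnS ltnS leq_addr /=.
  have -> : (l \in births l.+1 w) = false by apply/negP => /(IH l.+1)[]; rewrite ltnn.
  by rewrite orbF; case: s => [[||x] i];
    rewrite /= ?mem_seq1 ?eqxx; constructor => // -[].
have -> : (l \in match s.1 with Cup => [:: c] | _ => [::] end) = false.
  by case: s.1; rewrite //= inE (negbTE cl).
apply: (iffP (IH c.+1)) => -[/andP[H H'] E].
  by split; [lia | have -> : l - c = (l - c.+1).+1 by lia].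
split; first lia.
by move: E; have -> : l - c = (l - c.+1).+1 by lia.
Qed.

Lemma linksP (w : seq slice) (c : nat) (L : seq nat) (a b : nat) :
  (a, b) \in links c L w <-> exists l i,
  [/\ l < size w, nth (Cup, 0) w l = (Cap, i),
      a = nth 0 (labels c L (take l w)) i & b = nth 0 (labels c L (take l w)) i.+1].
Proof.
elim: w c L => [|s w IH] c L /=; first by split=> // -[l [i []]].
rewrite mem_cat; split.
  case/orP => [|/IH[l [i [H1 H2 H3 H4]]]]; last by exists l.+1, i.
  by case: s => [[||x] i] //=; rewrite inE => /eqP[-> ->]; exists 0, i.
move=> [[|l] [i [H1 H2 H3 H4]]]; apply/orP; last by right; apply/IH; exists l, i.
by left; move: H2 => /= ->; rewrite inE H3 H4 /= eqxx.
Qed.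

Section Components.

Variable D : diagram.
Local Notation w := (word D).
Local Notation piece_at l := (nth (Cup, 0) w l).
Local Notation lab l := (labels 0 [::] (take l w)).

Lemma strands_width (l : nat) : strands_after (take l w) = Some (width w l).
Proof.
rewrite /width; case E: (strands_after _) => [//|].
have := svalP D; rewrite /= -/(word D) /is_diagram -(cat_take_drop l w).
rewrite /strands_after foldl_cat.
have -> : foldl stack (Some 0) (take l w) = None by [].
by rewrite stack_None.
Qed.

Lemma widthS (l : nat) : l < size w ->
  (piece_at l).2 + inputs (piece_at l).1 <= width w l /\
  width w l.+1 = width w l - inputs (piece_at l).1 + outputs (piece_at l).1.
Proof.
move=> lw; have := strands_width l.+1.
rewrite (take_nth (Cup, 0) lw) /strands_after foldl_rcons.
have -> : foldl stack (Some 0) (take l w) = Some (width w l) by exact: strands_width.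
rewrite /=; case: ifP => // H [E].
by rewrite E.
Qed.

Lemma labS (l : nat) : l < size w -> lab l.+1 = relabel l (piece_at l) (lab l).
Proof.
move=> lw; rewrite (take_nth (Cup, 0) lw) -cats1 labels_cat add0n.
by rewrite size_takel // ltnW.
Qed.

Lemma size_lab (l : nat) : l <= size w -> size (lab l) = width w l.
Proof.
elim: l => [|l IH] lw; first by rewrite /width take0.
have [H ->] := widthS lw; rewrite labS // /relabel !size_cat size_drop.
rewrite IH ?(ltnW lw) // size_takel ?IH ?(ltnW lw) //; last first.
  exact: leq_trans (leq_addr _ _) H.
set p := (piece_at l) in H *; have -> : size match p.1 with
    | Cup => [:: l; l] | Cap => [::]
    | Cross _ => [:: nth 0 (lab l) p.2.+1; nth 0 (lab l) p.2] end = outputs p.1.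
  by case: p.1.
move: H; move: (inputs _) (outputs _); lia.
Qed.

Lemma nth_relabel_left (c j : nat) (s : slice) (L : seq nat) :
  s.2 <= size L -> j < s.2 -> nth 0 (relabel c s L) j = nth 0 L j.
Proof.
by move=> H Hj; rewrite /relabel nth_cat size_takel // Hj nth_take.
Qed.

Lemma nth_relabel_middle (c j : nat) (s : slice) (L : seq nat) :
  s.2 <= size L -> j < outputs s.1 -> nth 0 (relabel c s L) (s.2 + j) =
  match s.1 with
  | Cup => c
  | Cap => 0
  | Cross _ => if j == 0 then nth 0 L s.2.+1 else nth 0 L s.2
  end.
Proof.
move=> H; rewrite /relabel nth_cat size_takel // [s.2 + j < _]ltnNge leq_addr /= addKn.
by case: s.1 => [||x] //; case: j => [|[|j]].
Qed.

Lemma nth_relabel_right (c j : nat) (s : slice) (L : seq nat) :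
  s.2 <= size L -> s.2 <= j ->
  nth 0 (relabel c s L) (j + outputs s.1) = nth 0 L (j + inputs s.1).
Proof.
move=> H Hj; rewrite /relabel nth_cat size_takel //.
rewrite ltnNge (leq_trans Hj (leq_addr _ _)) /= nth_cat.
set m := match _ with Cup => _ | _ => _ end.
have -> : size m = outputs s.1 by rewrite /m; case: s.1.
have -> : (j + outputs s.1 - s.2 < outputs s.1) = false.
  by apply/negbTE; rewrite -leqNgt; lia.
by rewrite nth_drop; congr nth; lia.
Qed.

Definition point_at (p : nat * nat) : Prop := p.1 <= size w /\ p.2 < width w p.1.

Definition linked_points (p q : nat * nat) : Prop := exists x y : Defs.point w,
  [/\ coordinates x = p, coordinates y = q & connect (@joined w) x y].

Lemma coordinates_inj : injective (@coordinates w).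
Proof.
move=> [l j] [l' j'] [/= E]; move/val_inj: E j' => <- j' E.
by congr (Tagged _ _); apply: val_inj.
Qed.

Lemma point_coordinates (p : nat * nat) : point_at p ->
  exists x : Defs.point w, coordinates x = p.
Proof.
case: p => l j [/= Hl Hj].
by exists (Tagged (fun i : 'I__ => 'I_(width w i))
  (Ordinal Hj : 'I_(width w (Ordinal (Hl : l < (size w).+1))))).
Qed.

Lemma joined_sym : symmetric (@joined w).
Proof. by move=> x y; rewrite /joined orbC. Qed.

Lemma linked_refl (p : nat * nat) : point_at p -> linked_points p p.
Proof. by move=> /point_coordinates[x E]; exists x, x. Qed.

Lemma linked_sym (p q : nat * nat) : linked_points p q -> linked_points q p.
Proof.
move=> [x [y [Ex Ey H]]]; exists y, x; split=> //.
by rewrite (sym_connect_sym joined_sym).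
Qed.

Lemma linked_trans (p q r : nat * nat) :
  linked_points p q -> linked_points q r -> linked_points p r.
Proof.
move=> [x [y [Ex Ey H]]] [y' [z [Ey' Ez H']]]; exists x, z; split=> //.
by apply: connect_trans H _; rewrite (coordinates_inj (etrans Ey (esym Ey'))).
Qed.

Lemma mem_arcs (l : nat) (e : (nat * nat) * (nat * nat)) :
  l < size w -> e \in slice_arcs w l -> e \in arcs w.
Proof.
by move=> lw H; apply/flatten_mapP; exists l => //; rewrite mem_iota.
Qed.

Lemma linked_arc (p q : nat * nat) : (p, q) \in arcs w ->
  point_at p -> point_at q -> linked_points p q.
Proof.
move=> H /point_coordinates[x Ex] /point_coordinates[y Ey]; exists x, y; split=> //.
by apply: connect1; rewrite /joined Ex Ey H.
Qed.

Definition root_at (c : nat) : nat * nat := (c.+1, (piece_at c).2).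

Definition label (p : nat * nat) : nat := nth 0 (lab p.1) p.2.

Lemma arcs_left (l j : nat) : l < size w -> j < (piece_at l).2 ->
  ((l, j), (l.+1, j)) \in arcs w.
Proof.
move=> lw; move=> H; apply: (mem_arcs lw); rewrite /slice_arcs.
case: (piece_at l) H => p i /= H.
by rewrite mem_cat; apply/orP; left; apply/mapP; exists j; rewrite // mem_iota.
Qed.

Lemma arcs_right (l j : nat) : l < size w -> (piece_at l).2 <= j ->
  j < width w l - inputs (piece_at l).1 ->
  ((l, j + inputs (piece_at l).1), (l.+1, j + outputs (piece_at l).1)) \in arcs w.
Proof.
move=> lw H H'; apply: (mem_arcs lw); rewrite /slice_arcs.
case: (piece_at l) H H' => p i /= H H'.
rewrite !mem_cat; apply/orP; right; apply/orP; left; apply/mapP; exists j => //.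
rewrite mem_iota; lia.
Qed.

Lemma arcs_piece (l : nat) (e : (nat * nat) * (nat * nat)) : l < size w ->
  (let: (p, i) := piece_at l in
   e \in match p with
         | Cup => [:: ((l.+1, i), (l.+1, i.+1))]
         | Cap => [:: ((l, i), (l, i.+1))]
         | Cross _ => [:: ((l, i), (l.+1, i.+1)); ((l, i.+1), (l.+1, i))]
         end) -> e \in arcs w.
Proof.
move=> lw H; apply: (mem_arcs lw); rewrite /slice_arcs.
case: (piece_at l) H => p i H.
by rewrite !mem_cat H !orbT.
Qed.

(** By induction on the height: a strand is followed down to the minimum where it was born. *)
Lemma label_root (p : nat * nat) : point_at p ->
  label p \in births 0 w /\ linked_points p (root_at (label p)).
Proof.
case: p => l j [/=]; elim: l j => [|l IH] j lw; first by rewrite /width take0.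
move=> Hj; have [Hi W] := widthS lw; have SL := size_lab (ltnW lw).
have Si : (piece_at l).2 <= size (lab l).
  by rewrite SL; apply: leq_trans (leq_addr _ _) Hi.
have step j' : j' < width w l -> ((l, j'), (l.+1, j)) \in arcs w ->
    label (l.+1, j) = label (l, j') ->
    label (l.+1, j) \in births 0 w /\ linked_points (l.+1, j) (root_at (label (l.+1, j))).
  move=> Hj' A ->; have [H1 H2] := IH j' (ltnW lw) Hj'; split=> //.
  apply: linked_trans H2; apply: linked_sym; apply: (linked_arc A); split=> //=.
  exact: ltnW.
have [Hji|Hji] := ltnP j (piece_at l).2.
  apply: (step j); [by move: Si; rewrite SL; lia | exact: arcs_left |].
  by rewrite /label labS // nth_relabel_left.
have [Hjo|Hjo] := leqP ((piece_at l).2 + outputs (piece_at l).1) j.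
  set o := outputs _ in Hjo W; set n := inputs _ in Hi W.
  have Ej : j = j - o + o by lia.
  apply: (step (j - o + n)); first by lia.
    by rewrite {2}Ej; apply: arcs_right => //; lia.
  by rewrite /label labS //= {1}Ej nth_relabel_right //; lia.
have [d Ed] : exists d, j = (piece_at l).2 + d by exists (j - (piece_at l).2); lia.
have Hd : d < outputs (piece_at l).1 by lia.
have A e := @arcs_piece l e lw.
have EL : label (l.+1, j) = match (piece_at l).1 with
  | Cup => l
  | Cap => 0
  | Cross _ =>
      if d == 0 then nth 0 (lab l) (piece_at l).2.+1 else nth 0 (lab l) (piece_at l).2
  end by rewrite /label labS // Ed nth_relabel_middle.
case Ep : (piece_at l) EL A Hi W Hd Ed => [[||x] i] /= EL A Hi W Hd Ed; last 1 first.
- case: d Hd Ed EL => [|[|d]] //= _ Ed EL.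
    apply: (step i.+1); [lia | by apply: A; rewrite Ed addn0 !inE eqxx orbT | by []].
  by apply: (step i); [lia | by apply: A; rewrite Ed addn1 !inE eqxx | by []].
- rewrite EL; split; first by apply/birthsP; rewrite subn0 Ep.
  have P : point_at (l.+1, i) by split=> //=; lia.
  rewrite /root_at Ep /=; case: d Hd Ed => [|[|d]] //= _ Ed.
    by rewrite Ed addn0; apply: linked_refl.
  apply: linked_sym; apply: linked_arc => //.
  by apply: A; rewrite Ed addn1 inE.
by [].
Qed.

Lemma label_arc (p q : nat * nat) : (p, q) \in arcs w ->
  label p = label q \/ (label p, label q) \in links 0 [::] w.
Proof.
move=> /flatten_mapP[l]; rewrite mem_iota /= add0n => lw.
have [Hi W] := widthS lw; have SL := size_lab (ltnW lw).
have Si : (piece_at l).2 <= size (lab l).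
  by rewrite SL; apply: leq_trans (leq_addr _ _) Hi.
have M j : j < outputs (piece_at l).1 -> label (l.+1, (piece_at l).2 + j) =
  match (piece_at l).1 with
  | Cup => l
  | Cap => 0
  | Cross _ =>
      if j == 0 then nth 0 (lab l) (piece_at l).2.+1 else nth 0 (lab l) (piece_at l).2
  end by move=> Hj; rewrite /label labS // nth_relabel_middle.
have L j : j < (piece_at l).2 -> label (l.+1, j) = label (l, j).
  by move=> Hj; rewrite /label labS // nth_relabel_left.
have R j : (piece_at l).2 <= j -> label (l.+1, j + outputs (piece_at l).1) =
    label (l, j + inputs (piece_at l).1).
  by move=> Hj; rewrite /label labS // nth_relabel_right.
have K i : piece_at l = (Cap, i) -> (label (l, i), label (l, i.+1)) \in links 0 [::] w.
  by move=> E; apply/linksP; exists l, i.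
rewrite /slice_arcs.
case: (piece_at l) M L R K {Si Hi W} => c i /= M L R K.
rewrite !mem_cat => /orP[/mapP[j]|/orP[/mapP[j]|]].
- by rewrite mem_iota add0n => Hj [-> ->]; left; rewrite L.
- by rewrite mem_iota => /andP[Hj _] [-> ->]; left; rewrite R.
case: c M {L R} K => [||x] M K; rewrite !inE.
- move=> /eqP[-> ->]; left.
  by rewrite -{1}[i]addn0 -[i.+1]addn1 !M.
- by move=> /eqP[-> ->]; right; apply: K.
by case/orP => /eqP[-> ->]; left;
  [rewrite -[i.+1]addn1 M | rewrite -{2}[i]addn0 M].
Qed.

(** The map [r] selects one birth per component; the others must be linked to it by a single cap, as
    happens in the patterns. *)
Lemma components_labels (r : nat -> nat) (s : seq nat) : uniq s ->
  (forall c, c \in births 0 w -> r c \in s) ->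
  (forall c, c \in s -> c \in births 0 w /\ r c = c) ->
  (forall c, c \in births 0 w -> r c <> c -> (c, r c) \in links 0 [::] w) ->
  (forall a b, (a, b) \in links 0 [::] w -> r a = r b) ->
  components D = size s.
Proof.
move=> us rs sr rl lr.
have root_point c : c \in births 0 w -> point_at (root_at c) /\ label (root_at c) = c.
  move=> /birthsP[/andP[_ cw]]; rewrite subn0 => E.
  have [] := widthS cw; rewrite E /= addn0 subn0 => H W.
  split; first by split=> //=; lia.
  rewrite /label labS //= -[(piece_at c).2]addn0 nth_relabel_middle ?E //.
  by rewrite size_lab // ltnW.
have point_of (x : Defs.point w) : point_at (coordinates x).
  by case: x => l j; split=> //=; rewrite -ltnS.
pose f (x : Defs.point w) := r (label (coordinates x)).
have joined_f x y : joined x y -> f x = f y.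
  case/orP => /label_arc[E|/lr E]; rewrite /f ?E //.
have connect_f x y : connect (@joined w) x y -> f x = f y.
  case/connectP => p; elim: p x => [|z p IH] x /=; first by move=> _ ->.
  by move=> /andP[/joined_f -> H] /(IH _ H).
have to_root x : linked_points (coordinates x) (root_at (f x)).
  have [B H] := label_root (point_of x); apply: linked_trans H _.
  rewrite /f; set c := label _ in B *; have [->|/eqP N] := eqVneq (r c) c.
    by apply: linked_refl; have [] := root_point c B.
  have /linksP[l [i [lw Ep Ec Er]]] := rl _ B N.
  have [Hi _] := widthS lw; move: Hi; rewrite Ep /= => Hi.
  have P1 : point_at (l, i) by split=> /=; lia.
  have P2 : point_at (l, i.+1) by split=> /=; lia.
  have [_ H1] := label_root P1; have [_ H2] := label_root P2.
  rewrite {1}Ec Er; apply: linked_trans (linked_sym H1) _; apply: linked_trans H2.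
  apply: linked_arc => //; apply: arcs_piece lw _.
  by rewrite Ep inE.
apply: (@n_comp_image _ _ f) => //.
- exact: joined_sym.
- by move=> x; apply: rs; have [] := label_root (point_of x).
- move=> c /sr[B E]; have [/point_coordinates[x Ex] Ec] := root_point c B.
  by exists x; rewrite /f Ex Ec.
move=> x y; apply/idP/eqP => [/connect_f//|E].
have H := to_root x; rewrite E in H.
have [x' [y' [Ex Ey]]] := linked_trans H (linked_sym (to_root y)).
by rewrite (coordinates_inj Ex) (coordinates_inj Ey).
Qed.

End Components.

Lemma births_ge (c l : nat) (w : seq slice) : l \in births c w -> c <= l.
Proof. by move=> /birthsP[/andP[]]. Qed.

Lemma births_uniq (c : nat) (w : seq slice) : uniq (births c w).
Proof.
elim: w c => //= -[[||x] i] w IH c; rewrite /= IH ?andbT //.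
by apply/negP => /births_ge; rewrite ltnn.
Qed.

Lemma size_births_trivial (c k : nat) : size (births c (trivial_word k)) = k.
Proof. by elim: k c => //= k IH c; rewrite IH. Qed.

Lemma links_trivial (c k a b : nat) :
  (a, b) \in links c [::] (trivial_word k) -> a = b.
Proof.
elim: k c => //= k IH c; rewrite inE => /orP[/eqP[-> -> //]|].
exact: IH.
Qed.

Lemma births_repeat (c n : nat) (w : seq slice) :
  (forall c, births c w = [::]) -> births c (repeat n w) = [::].
Proof. by move=> H; elim: n c => // n IH c; rewrite repeatS births_cat H IH. Qed.

Lemma labels_repeat (c n : nat) (L : seq nat) (w : seq slice) :
  (forall c, labels c L w = L) -> labels c L (repeat n w) = L.
Proof. by move=> H; elim: n c => // n IH c; rewrite repeatS labels_cat H IH. Qed.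

Lemma links_repeat (c n : nat) (L : seq nat) (w : seq slice) :
  (forall c, links c L w = [::]) -> (forall c, labels c L w = L) ->
  links c L (repeat n w) = [::].
Proof.
by move=> H H'; elim: n c => // n IH c; rewrite repeatS links_cat H H' IH.
Qed.

Lemma components_pattern (n m r k : nat) (x : crossing) (b : bool) :
  components (pattern_diagram n m r k x b) = k.+2.
Proof.
set q := 3 + size (repeat n (twist x 1)).
set T := q + size (knot m r b).
have Eq : size (chain n x) = q by rewrite /chain !size_cat /= addnA addn1.
have EB : births 0 (pattern n m r k x b) = [:: 0; 1; q] ++ births T (trivial_word k).
  rewrite births_cat add0n Eq births_cat -/T catA; congr (_ ++ _).
  rewrite /chain /knot !births_cat !births_repeat //= !cats0.
have EL : links 0 [::] (pattern n m r k x b) =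
    [:: (1, 1); (0, q); (q, 0)] ++ links T [::] (trivial_word k).
  have L1 : labels 0 [::] (chain n x) = [:: 0; 0].
    by rewrite /chain !labels_cat /= labels_repeat.
  have L2 : labels q [:: 0; 0] (knot m r b) = [::].
    by rewrite /knot !labels_cat /= !labels_repeat.
  rewrite links_cat add0n Eq links_cat -/T L1 L2 catA; congr (_ ++ _).
  rewrite /chain /knot !links_cat /=.
  by rewrite !links_repeat ?labels_repeat.
have T3 : q < T by rewrite /T /knot size_cat /=; lia.
rewrite -[k.+2](_ : size (0 :: 1 :: births T (trivial_word k)) = _); last first.
  by rewrite /= size_births_trivial.
(* The cup of [knot], at height q, lies on the component born at height 0. *)
apply: (@components_labels _ (fun c => if c == q then 0 else c)).
- rewrite /= births_uniq inE andbT; apply/andP; split.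
    by apply/negP => /births_ge; lia.
  by apply/negP => /births_ge; lia.
- move=> c; rewrite EB mem_cat !inE; have [//|_] := eqVneq c q.
  by rewrite orbF orbA.
- move=> c; rewrite EB mem_cat !inE => H; have Hc : c <> q.
    move=> E; move: H; rewrite E /q /= => /births_ge; lia.
  by have [//|_] := eqVneq c q; rewrite orbF -orbA.
- move=> c _; have [->|//] := eqVneq c q.
  by rewrite EL !inE eqxx !orbT.
move=> a a'; rewrite EL mem_cat => /orP[|/links_trivial->//].
have q0 : (0 == q) = false by [].
have q1 : (1 == q) = false by [].
rewrite !inE => /or3P[] /eqP[-> ->]; by rewrite ?eqxx ?q0 ?q1.
Qed.

(** * The unknotting index of the examples *)

Local Open Scope classical_set_scope.

(** The span n must drop to 0, which needs n' >= n. In case of equality the labels survive, and the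
    writhe m must drop to 0 as well. *)
Lemma lower_bound (n m r k n' m' : nat) (D E : diagram) (l : nat) : 0 < r ->
  equivalent (pattern_diagram n m r k (Classical true) false) D ->
  modified n' m' (word D) (word E) -> equivalent E (trivial_diagram l) ->
  n < n' \/ n = n' /\ m <= m'.
Proof.
move=> r0 HD M HE; set f := indicator (2 * Z.of_nat r).
have r2 : (2 * Z.of_nat r <> 0)%Z by move/ltP: r0; lia.
have f0 : f 0%Z = 0%Z by rewrite /f indicator_neq //; lia.
have Hf d : (Z.abs (f d + f (- d)) <= 1)%Z.
  by have := indicator_sum d r2; rewrite -/f; lia.
have S : sem 1 f (word D) start (target (Z.of_nat n) (Z.of_nat m)).
  by apply/(@sem_equivalent 1 f _ _ _ _ f0 HD); apply: pattern_sem.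
have [p [S1 Hn Hm]] := modified_weights Hf M 0 0 S.
(* [E] is equivalent to a crossingless diagram, so its colourings have weight zero. *)
have T h g C C' : g 0%Z = 0%Z -> sem h g (word E) C C' -> C'.2 = C.2.
  move=> g0 /(@sem_equivalent h g _ _ _ _ g0 HE).
  exact: sem_crossingless (crossingless_trivial l).
have p0 : p = 0%Z by have := T _ _ _ _ erefl S1 => -[].
subst p; rewrite /= in Hn Hm.
have [E1|E1] := Z.eq_dec (Z.of_nat n) (Z.of_nat n'); last by left; apply/ltP; lia.
right; have {}E1 : n = n' by lia.
split=> //; have [|q S2] := Hm; first by rewrite E1; lia.
by have [->] := T _ _ _ _ f0 S2 => H; apply/leP; lia.
Qed.

(** The parameter i + 1 keeps the index of the clasps nonzero. *)
Definition example (n m k i : nat) : diagram :=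
  pattern_diagram n m i.+1 k (Classical true) false.

Lemma unknottable_example (n m k i : nat) : unknottable (example n m k i) (n, m).
Proof.
exists (pattern_diagram n m i.+1 k Virtual true); split; first exact: modified_pattern.
by rewrite components_pattern; apply: pattern_trivial.
Qed.

Lemma unknottable_equivalent (n m k i : nat) (D : diagram) (q : nat * nat) :
  equivalent (example n m k i) D -> unknottable D q ->
  (((n, m) : nat *l nat) <= (q : nat *l nat))%O.
Proof.
case: q => n' m' HD [E [M HE]]; rewrite Order.ProdLexiOrder.leEprodlexi !leEnat /=.
have [lt|[-> ->]] := lower_bound (ltn0Sn i) HD M HE; last by rewrite leqnn.
by rewrite ltnW //= leqNgt lt.
Qed.

Lemma unknotting_index_example (n m k i : nat) :
  unknotting_index [set E | equivalent (example n m k i) E]%classic (n, m).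
Proof.
split; last first.
  by move=> q [D HD [HU _]]; exact: unknottable_equivalent HD HU.
exists (example n m k i); first exact: rst_refl.
split; first exact: unknottable_example.
by move=> q; apply: unknottable_equivalent; apply: rst_refl.
Qed.

(** The colouring of weight (n, m) at index i + 1 is carried over to the second diagram, whose
    clasps have index j + 1 up to sign. *)
Lemma example_inj (n m k i j : nat) : 0 < n -> 0 < m ->
  equivalent (example n m k i) (example n m k j) -> i = j.
Proof.
move=> n0 /ltP m0 H; apply: succn_inj.
have S := @pattern_sem n m i.+1 k (ltn0Sn i).
have {}S := (@sem_equivalent 1 _ _ _ _ _ (indicator_neq _) H).1 S.
apply: (sem_pattern_indicator n0 (ltn0Sn i) (ltn0Sn j) (S _)); lia.
Qed.

Theorem theorem3p4 (n m k : nat) (hn : 0 < n) (hm : 0 < m) (hk : 1 < k) :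
  infinite_set [set L : set diagram |
                 virtual_link k L /\ unknotting_index L (n, m)].
Proof.
(* Two of the k components are the circle of [chain] and the component closed by [knot]. *)
pose F i := [set E | equivalent (example n m k.-2 i) E].
have FA : range F `<=` [set L : set diagram |
    virtual_link k L /\ unknotting_index L (n, m)].
  move=> _ [i _ <-]; split; last exact: unknotting_index_example.
  exists (example n m k.-2 i); split=> //.
  by rewrite components_pattern; case: (k) hk => [|[]].
apply: (sub_infinite_set FA) => fin.
apply: infinite_nat; apply: (sub_finite_set _ (finite_preimage (f := F) _ fin)).
  by move=> i _; exists i.
move=> i j _ _ E; apply: (@example_inj n m k.-2 i j) => //.
have : F j (example n m k.-2 j) by apply: rst_refl.
by rewrite -E.
Qed.
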